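(* Let $k$ be an algebraically closed field, $R=k[x,y,z]$, and let $X=V(f)\subset\mathbb P^2_k$ be a singular reduced curve of degree $d+1$, $d\geq 1$, where $\operatorname{char}(k)$ does not divide $d+1$. Let $e=\operatorname{indeg}(\operatorname{Syz}(J_f))$. Then $\operatorname{Bour}(X)=2$ if and only if $R/J_f$ has a graded minimal free resolution of the form $$0\to R(-(d+(d-e+3)))\to R(-(d+(d-e+2)))\oplus R(-(d+(d-e+1)))\oplus R(-(d+e))\to R(-d)^3\to R\to R/J_f\to 0,$$ where $e\leq (d+1)/2$.
   Context: $J_f=(f_x,f_y,f_z)\subset R$ is the gradient ideal. $\operatorname{Syz}(J_f)=\{(a,b,c)\in R^3: af_x+bf_y+cf_z=0\}$ is graded as a submodule of $R^3$ (a syzygy has degree $n$ if its coordinates are forms of degree $n$). For a graded module $M=\bigoplus_{i\ge 0}M_i$, $\operatorname{indeg}(M)=\min\{i: M_i\ne 0\}$. The curve $X$ (or $f$) is a free divisor if $\operatorname{Syz}(J_f)$ is a free $R$-module. Bourbaki degree: let $e=\operatorname{indeg}(\operatorname{Syz}(J_f))$. If $f$ is a free divisor, set $\operatorname{Bour}(X)=0$. Otherwise choose a minimal generator $\epsilon\in\operatorname{Syz}(J_f)$ of degree $e$; the cokernel of $R(-e)\stackrel{\epsilon}{\to}\operatorname{Syz}(J_f)$ is isomorphic, by a degree-zero graded isomorphism, to $I_\epsilon(e-d)$ for a proper homogeneous ideal $I_\epsilon\subset R$ of codimension two, and $\operatorname{Bour}(X):=\deg(R/I_\epsilon)$ (algebraic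 multiplicity), which does not depend on the choice of $\epsilon$ of degree $e$. *)

(* Defs.v *)
From HB Require Import structures.
From mathcomp Require Import all_boot all_order all_algebra.
From mathcomp Require Import mpoly.

Set Implicit Arguments.
Unset Strict Implicit.
Unset Printing Implicit Defensive.

Import GRing.Theory.
Local Open Scope ring_scope.

(* Ideals and primes of a commutative ring, as Prop-valued predicates.        *)

Section Ideals.
Variable A : comNzRingType.
Implicit Types I P Q : A -> Prop.

Definition is_ideal I : Prop :=
  [/\ I 0, forall p q, I p -> I q -> I (p + q) & forall a p, I p -> I (a * p)].

Definition proper_ideal I : Prop := is_ideal I /\ ~ I 1.

Definition prime_ideal P : Prop :=
  proper_ideal P /\ forall p q, P (p * q) -> P p \/ P q.

Definition ideal_sub I Q : Prop := forall p, I p -> Q p.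

Definition ideal_psub I Q : Prop := ideal_sub I Q /\ ~ ideal_sub Q I.

(* There is a chain of primes c_0 < c_1 < ... < c_h = P.                      *)
Definition height_ge P (h : nat) : Prop :=
  exists c : nat -> A -> Prop,
    [/\ forall i, (i <= h)%N -> prime_ideal (c i),
        forall i, (i < h)%N -> ideal_psub (c i) (c i.+1)
      & forall p, c h p <-> P p].

(* The minimum of the heights of the primes containing I is h.                *)
Definition codim I (h : nat) : Prop :=
  (forall P, prime_ideal P -> ideal_sub I P -> height_ge P h) /\
  exists P, [/\ prime_ideal P, ideal_sub I P & ~ height_ge P h.+1].

Definition ideal_gen n (g : 'I_n -> A) : A -> Prop :=
  fun p => exists a : 'I_n -> A, p = \sum_i a i * g i.

(* The quotient ring A/(f) has no nonzero nilpotent element.                  *)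
Definition reduced_quotient (f : A) : Prop :=
  forall g n, ideal_gen (fun _ : 'I_1 => f) (g ^+ n) ->
              ideal_gen (fun _ : 'I_1 => f) g.

End Ideals.

Section Modules.
Variables (A : comNzRingType) (M : lmodType A).

(* Freeness of a finitely generated module: a basis is then finite.           *)
Definition free_module : Prop :=
  exists (n : nat) (phi : {linear 'rV[A]_n -> M}), bijective phi.

Definition generates_outside n (g : 'I_n -> M) (D : {set 'I_n}) : Prop :=
  forall v, exists a : 'I_n -> A, v = \sum_(i | i \notin D) a i *: g i.

Definition minimal_generators n (g : 'I_n -> M) : Prop :=
  generates_outside g set0 /\ forall i, ~ generates_outside g [set i].

End Modules.

Section Graded.
Variable k : fieldType.
Local Notation R := {mpoly k[3]}.
Implicit Types I : R -> Prop.

(* p lies in R_n, where R_n = 0 for n < 0.                                    *)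
Definition is_form (n : int) (p : R) : bool :=
  if n is Posz m then p \is m.-homog else p == 0.

Definition homogeneous_ideal I : Prop :=
  is_ideal I /\ forall p n, I p -> I (pihomog mdeg n p).

(* H n is the dimension of the degree n component of R/I.                     *)
Definition hilbert_function I (H : nat -> nat) : Prop :=
  forall n, exists2 U : {vspace dhomog 3 k n},
    forall p, p \in U <-> I (mpoly_of_dhomog p)
    & H n = (\dim {:dhomog 3 k n} - \dim U)%N.

(* The multiplicity of R/I: (degree of P)! times the leading coefficient of   *)
(* the Hilbert polynomial P, and the length of R/I when P = 0.                *)
Definition multiplicity I (m : nat) : Prop :=
  exists (H : nat -> nat) (P : {poly rat}) (N : nat),
    [/\ hilbert_function I H,
        forall n, (N <= n)%N -> (H n)%:R = P.[n%:R]
      & if P == 0 then m = (\sum_(n < N) H n)%N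
        else m%:R = lead_coef P * ((size P).-1)`!%:R].

(* Row vectors are multiplied on the right by B : 'M_(m, n); B is a degree-0  *)
(* graded map from the sum of the R(- a_i) to the sum of the R(- b_j).        *)
Definition graded_mx m n (a : m.-tuple int) (b : n.-tuple int)
    (B : 'M[R]_(m, n)) : Prop :=
  forall i j, is_form (tnth a i - tnth b j) (B i j).

(* The image of B lies in (x, y, z) times its target.                         *)
Definition minimal_mx m n (B : 'M[R]_(m, n)) : Prop :=
  forall i j, (B i j)@_0%MM = 0.

Definition exact_at m n p (B : 'M[R]_(m, n)) (C : 'M[R]_(n, p)) : Prop :=
  forall u : 'rV[R]_n, u *m C = 0 <-> exists v : 'rV[R]_m, u = v *m B.

(* R/I has a graded minimal free resolution                                   *)
(*   0 -> sum R(- c_i) -> sum R(- b_i) -> sum R(- a_i) -> R -> R/I -> 0.      *)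
Definition graded_min_free_res I n1 n2 n3 (c : n3.-tuple int)
    (b : n2.-tuple int) (a : n1.-tuple int) : Prop :=
  exists (B3 : 'M[R]_(n3, n2)) (B2 : 'M[R]_(n2, n1)) (B1 : 'M[R]_(n1, 1)),
    [/\ [/\ graded_mx c b B3, graded_mx b a B2 & graded_mx a [tuple 0] B1],
        [/\ minimal_mx B3, minimal_mx B2 & minimal_mx B1]
      & [/\ forall u : 'rV_n3, u *m B3 = 0 -> u = 0,
            exact_at B3 B2,
            exact_at B2 B1
          & forall p, I p <-> exists v : 'rV_n1, p = (v *m B1) 0 0]].

End Graded.

Section Syzygies.
Variables (k : fieldType) (f : {mpoly k[3]}).
Local Notation R := {mpoly k[3]}.

Definition gradient_ideal : R -> Prop := ideal_gen (fun i : 'I_3 => f^`M(i)).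

Definition syz_pred : {pred 'rV[R]_3} :=
  fun v => \sum_(i < 3) v 0 i * f^`M(i) == 0.

Fact syz_pred_submod_closed : submod_closed syz_pred.
Proof.
split=> [|a u v /eqP u0 /eqP v0]; apply/eqP.
  by rewrite big1 // => i _; rewrite mxE mul0r.
under eq_bigr do rewrite !mxE mulrDl -mulrA.
by rewrite big_split /= -big_distrr /= u0 v0 mulr0 addr0.
Qed.

HB.instance Definition _ :=
  GRing.isSubmodClosed.Build R 'rV[R]_3 syz_pred syz_pred_submod_closed.

Record Syz := MkSyz { syz_val :> 'rV[R]_3; _ : syz_val \in syz_pred }.

HB.instance Definition _ := [isSub for syz_val].
HB.instance Definition _ := [Choice of Syz by <:].
HB.instance Definition _ := [SubChoice_isSubLmodule of Syz by <:].

Definition syz_homog (n : nat) (v : Syz) : Prop :=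
  forall i, syz_val v 0 i \is n.-homog.

Definition indeg_syz (e : nat) : Prop :=
  (exists2 v, syz_homog e v & v != 0) /\
  forall n v, syz_homog n v -> v != 0 -> (e <= n)%N.

Definition free_divisor : Prop := free_module Syz.

(* A member of a minimal system of homogeneous generators.                    *)
Definition minimal_generator (v : Syz) : Prop :=
  exists (n : nat) (g : 'I_n -> Syz) (i : 'I_n),
    [/\ forall j, exists m, syz_homog m (g j),
        minimal_generators g & v = g i].

(* I is a proper homogeneous ideal of codimension two whose shift I(e - d) is *)
(* isomorphic to Syz / R eps by a degree-0 graded isomorphism, induced by a   *)
(* linear map phi on Syz with kernel R eps and image I.                       *)
Definition bourbaki_ideal (d e : nat) (eps : Syz) (I : R -> Prop) : Prop :=
  [/\ proper_ideal I, homogeneous_ideal I, codim I 2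
    & exists phi : {linear Syz -> R^o},
        [/\ forall n v, syz_homog n v -> is_form (n%:Z + (e%:Z - d%:Z)) (phi v),
            forall v, phi v = 0 <-> exists a : R, v = a *: eps
          & forall p : R, I p <-> exists v, phi v = p]].

(* Here f is a form of degree d + 1.  The value b does not depend on the      *)
(* choice of eps and I.                                                       *)
Definition bourbaki_degree (d b : nat) : Prop :=
  (free_divisor /\ b = 0%N) \/
  (~ free_divisor /\
   exists (e : nat) (eps : Syz) (I : R -> Prop),
     [/\ indeg_syz e, syz_homog e eps, minimal_generator eps,
         bourbaki_ideal d e eps I & multiplicity I b]).

Definition singular_curve : Prop :=
  exists v : 'I_3 -> k,
    [/\ exists i, v i != 0, f.@[v] = 0 & forall i : 'I_3, (f^`M(i)).@[v] = 0].

End Syzygies.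

(* Main.v *)
(* If Bour(X) = 2, write I for the Bourbaki ideal. The Koszul complex shows that
   I is saturated, and the exact sequence 0 -> R(-e) -> Syz -> I(e - d) -> 0
   bounds the Hilbert function of R/I, so it is eventually 2. A linear form
   regular on R/I then forces the values 1, 2, 2, ..., whence I = (l, q) with l
   linear and q a quadric. Lifts L, Q of l, q together with eps generate Syz, and
   the unique relation l Q - q L + c eps = 0 gives the resolution. It is minimal
   because e > 0: a constant eps would let one divide L by l and put 1 in I.
   Conversely the resolution presents Syz by three generators with a single
   relation (l, q, c). Minimality of the degree e of the third generator forces
   l to be nonzero and not to divide q, so sending the generators to q, -l, 0
   identifies Syz / R eps with (l, q), an ideal of codimension and degree two.
   That (l, q) lies in a prime of height two rests on the absence of chains of
   five primes in k[x, y, z]. *)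

Require Import Defs.
From HB Require Import structures.
From mathcomp Require Import all_boot all_order all_algebra.
From mathcomp Require Import mpoly.
From mathcomp Require Import zify ring.
From Stdlib Require Import ClassicalEpsilon.

Set Implicit Arguments.
Unset Strict Implicit.
Unset Printing Implicit Defensive.

Import GRing.Theory.
Local Open Scope ring_scope.

(** * Forms in three variables *)

(** Multiplicity is read off a Hilbert polynomial, so the bound on the Hilbert function of R/I must
    first be turned into constancy of that polynomial; the zero polynomial, where multiplicity means
    length, is excluded by saturation. The regular linear form is found by linear algebra instead of
    associated primes: it suffices to have it in a single degree where R/I has dimension two, since
    regularity then spreads to every degree by comparing dimensions. Codimension is defined through
    chains of arbitrary primes, homogeneous or not, so a bound on the Krull dimension of R enters;
    it comes from counting monomials in four elements. In the converse, the map R(-d)^3 -> R of the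
    resolution is given by some generators of J_f and not by the partial derivatives; minimality
    makes the passage between the two an invertible constant matrix. *)

Lemma ord3_ind (P : 'I_3 -> Prop) : P 0 -> P 1 -> P 2%:R -> forall i, P i.
Proof.
move=> h0 h1 h2 [[|[|[|//]]] hi].
- by have -> : Ordinal hi = 0 by exact: val_inj.
- by have -> : Ordinal hi = 1 by exact: val_inj.
- by have -> : Ordinal hi = 2%:R by exact: val_inj.
Qed.

Lemma sum_ord3 (V : nmodType) (F : 'I_3 -> V) : \sum_i F i = F 0 + F 1 + F 2%:R.
Proof.
rewrite !big_ord_recl big_ord0 addr0 addrA.
by congr (F _ + F _ + F _); apply: val_inj.
Qed.

Section Forms.
Variable k : fieldType.
Local Notation R := {mpoly k[3]}.
Implicit Types (p q l t : R).

Lemma homog0_const (p : R) : p \is 0.-homog -> p = (p@_0%MM)%:MP.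
Proof.
move=> hp; apply/mpolyP=> m; rewrite mcoeffC.
case: (m =P 0%MM) => [->|/eqP nm]; first by rewrite ?eqxx mulr1.
rewrite mulr0; apply: (dhomog_nemf_coeff hp).
by rewrite mdeg_eq0.
Qed.

Lemma homog_coef0 n p : (0 < n)%N -> p \is n.-homog -> p@_0%MM = 0.
Proof. by move=> n0 hp; apply: (dhomog_nemf_coeff hp); rewrite mf0 neq_ltn n0. Qed.

Lemma homogX (i : 'I_3) : ('X_i : R) \is 1.-homog.
Proof. by rewrite dhomogX /= mdeg1. Qed.

Lemma form_decomp n p : p \is n.+1.-homog ->
  exists q : 'I_3 -> R, (forall i, q i \is n.-homog) /\ p = \sum_i 'X_i * q i.
Proof.
move=> /dhomogP hp; rewrite [p]mpolyE.
have: forall m, m \in msupp p -> mdeg m = n.+1 by exact: hp.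
elim: (msupp p) => [_|m s IH hs].
  exists (fun=> 0); split=> [i|]; first exact: dhomog0.
  by rewrite big_nil big1 // => i _; rewrite mulr0.
have [|u [hu su]] := IH; first by move=> m' hm'; apply: hs; rewrite inE hm' orbT.
have hm : mdeg m = n.+1 by apply: hs; rewrite inE eqxx.
have [i hi] : exists i, (0 < m i)%N.
  apply/existsP; rewrite -[X in is_true X]negbK negb_exists; apply/negP=> /forallP h0.
  have : mdeg m = 0%N by rewrite mdegE big1 // => i _; have := h0 i; rewrite -eqn0Ngt => /eqP.
  by rewrite hm.
have em : m = (U_(i) + (m - U_(i)))%MM.
  by rewrite addmC submK //; apply/mnm_lepP => j; rewrite mnm1E; case: eqP => // <-.
exists (fun j => u j + (if j == i then p@_m *: 'X_[m - U_(i)] else 0)); split.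
  move=> j; apply: rpredD => //; case: eqP => _; last exact: dhomog0.
  apply: rpredZ; rewrite dhomogX; apply/eqP.
  by have := congr1 mdeg em; rewrite mdegD mdeg1 hm add1n => -[].
rewrite big_cons su addrC; under [RHS]eq_bigr do rewrite mulrDr.
rewrite big_split /=; congr (_ + _).
rewrite (bigD1 i) //= eqxx big1 ?addr0; last by move=> j /negbTE ->; rewrite mulr0.
by rewrite -scalerAr -mpolyXD -em.
Qed.

Lemma linear_form_eval l : l \is 1.-homog -> l = \sum_i (l@_U_(i)%MM)%:MP * 'X_i.
Proof.
move=> hl; have [q [hq el]] := form_decomp hl.
have eq i : q i = (l@_U_(i)%MM)%:MP.
  rewrite el raddf_sum /= (bigD1 i) //= (homog0_const (hq i)) mulrC mul_mpolyC mcoeffZ.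
  rewrite mcoeffX eqxx mulr1 big1 ?addr0 // => j nj.
  rewrite (homog0_const (hq j)) mulrC mul_mpolyC mcoeffZ mcoeffX.
  by rewrite (_ : (U_(j)%MM == U_(i)%MM) = false) ?mulr0 //; apply/eqP=> /mnmP /(_ j);
     rewrite !mnm1E eqxx eq_sym (negbTE nj).
by rewrite {1}el; apply: eq_bigr => i _; rewrite eq mulrC.
Qed.

Definition divides l p := exists t, p = l * t.

(** Solving l = 0 for a variable that occurs in l gives an endomorphism [s] with kernel (l), which
    realises R/(l) inside the domain R; this is what makes l prime. The last clause is checked on
    monomials, one power of a variable at a time, since a - b divides a^n - b^n. *)
Lemma linear_form_prime_subst l : l \is 1.-homog -> l != 0 ->
  exists (s : {rmorphism R -> R}) (j : 'I_3),
  [/\ s l = 0, l@_U_(j)%MM != 0, forall i, i != j -> s 'X_i = 'X_i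
    & forall p, divides l (p - s p)].
Proof.
move=> hl nl.
have [j cj] : exists j, l@_U_(j)%MM != 0.
  apply/existsP; apply: contraNT nl; rewrite negb_exists => /forallP h.
  rewrite (linear_form_eval hl) big1 // => i _.
  by have := h i; rewrite negbK => /eqP ->; rewrite mpolyC0 mul0r.
set c := l@_U_(j)%MM in cj.
pose T := [tuple (if i == j then 'X_i - c^-1 *: l else 'X_i) | i < 3].
exists (comp_mpoly T), j; split=> //.
  rewrite [in LHS](linear_form_eval hl) raddf_sum /=.
  under eq_bigr do rewrite rmorphM /= comp_mpolyC comp_mpolyXU -tnth_nth tnth_mktuple.
  have -> : \sum_(i < 3) (l@_U_(i)%MM)%:MP * (if i == j then 'X_i - c^-1 *: l else 'X_i) =
            \sum_(i < 3) ((l@_U_(i)%MM)%:MP * 'X_i - (if i == j then l else 0)).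
    apply: eq_bigr => i _; case: eqP => [->|_]; last by rewrite subr0.
    by rewrite mulrBr !mul_mpolyC scalerA mulfV // scale1r.
  by rewrite big_split /= -linear_form_eval // sumrN -big_mkcond big_pred1_eq subrr.
  by move=> i /negbTE ni; rewrite /= comp_mpolyXU -tnth_nth tnth_mktuple ni.
have dD p q : divides l p -> divides l q -> divides l (p + q).
  by move=> [a ->] [b ->]; exists (a + b); rewrite mulrDr.
elim/mpolyind=> [|a m p _ _ IH]; first by exists 0; rewrite rmorph0 subr0 mulr0.
rewrite rmorphD opprD addrACA; apply: dD => //.
rewrite /= comp_mpolyZ -scalerBr.
suff [t ->] : divides l ('X_[m] - ('X_[m] \mPo T)) by exists (a *: t); rewrite scalerAr.
rewrite mpolyXE_id rmorph_prod /=.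
elim/big_rec2: _ => [|i y1 y2 _ [t Ht]]; first by exists 0; rewrite subrr mulr0.
have [u Hu] : divides l ('X_i ^+ m i - ('X_i ^+ m i \mPo T)).
  rewrite rmorphXn /= comp_mpolyXU -tnth_nth tnth_mktuple.
  case: eqP => _; last by exists 0; rewrite subrr mulr0.
  rewrite subrXX opprB addrCA subrr addr0 -mul_mpolyC (mulrC (_)%:MP) -mulrA.
  by eexists; reflexivity.
have -> : 'X_i ^+ m i * y2 - ('X_i ^+ m i \mPo T) * y1 =
          'X_i ^+ m i * (y2 - y1) + ('X_i ^+ m i - ('X_i ^+ m i \mPo T)) * y1 by ring.
by exists ('X_i ^+ m i * t + u * y1); rewrite Ht Hu; ring.
Qed.

Lemma linear_form_prime l p q : l \is 1.-homog -> l != 0 ->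
  divides l (p * q) -> divides l p \/ divides l q.
Proof.
move=> hl nl [t et]; have [s [_ [sl _ _ hs]]] := linear_form_prime_subst hl nl.
have dvds r : s r = 0 -> divides l r by move=> e; have := hs r; rewrite e subr0.
have /eqP : s p * s q = 0 by rewrite -rmorphM et rmorphM sl mul0r.
by rewrite mulf_eq0 => /orP[] /eqP /dvds; [left|right].
Qed.

Lemma variable_divides_neq (i j : 'I_3) : i != j -> ~ divides 'X_i 'X_j.
Proof.
move=> nij [t /(congr1 (meval (fun a => (a == j)%:R)))].
by rewrite mevalM !mevalXU eqxx (negbTE nij) mul0r => /eqP; rewrite oner_eq0.
Qed.

Lemma pihomogM n m l t : l \is m.-homog ->
  pihomog mdeg (m + n) (l * t) = l * pihomog mdeg n t.
Proof.
move=> hl; set N := maxn (msize t) n.+1.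
rewrite {1}(@pihomog_partitionE _ _ mdeg N t) ?leq_maxl //.
rewrite mulr_sumr raddf_sum /=.
have hn : (n < N)%N by rewrite leq_max ltnSn orbT.
rewrite (bigD1 (Ordinal hn)) //= big1 ?addr0.
  by rewrite pihomog_dE //; apply: dhomogM => //; apply: pihomogP.
move=> i ni; apply: (@pihomog_ne0 _ _ mdeg (m + i)).
  by rewrite eqn_add2l.
by apply: dhomogM => //; apply: pihomogP.
Qed.

Lemma pihomogM_small n m l t : l \is m.-homog -> (n < m)%N ->
  pihomog mdeg n (l * t) = 0.
Proof.
move=> hl nm.
rewrite {1}(@pihomog_partitionE _ _ mdeg (msize t) t) //.
rewrite mulr_sumr raddf_sum /= big1 // => i _.
apply: (@pihomog_ne0 _ _ mdeg (m + i)); first by rewrite neq_ltn orbC ltn_addr.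
by apply: dhomogM => //; apply: pihomogP.
Qed.

Lemma homog_cofactor n m l t : l \is m.-homog -> l != 0 ->
  l * t \is (m + n).-homog -> t \is n.-homog.
Proof.
move=> hl nl hp; have := pihomog_dE hp; rewrite pihomogM // => /(mulfI nl) <-.
exact: pihomogP.
Qed.

Lemma homog_cofactor_small n m l t : l \is m.-homog -> (n < m)%N ->
  l * t \is n.-homog -> l * t = 0.
Proof. by move=> hl nm hp; rewrite -(pihomog_dE hp) (pihomogM_small _ hl nm). Qed.

(** Modulo ['X_0] the hypothesis is a syzygy of ['X_1] and ['X_2], and the prime ['X_1] does not
    divide ['X_2]. The witness [r] comes from this reduction; [be] and [ga] are the corrections
    along ['X_0]. *)
Lemma koszul_two (b c : R) : divides 'X_0 ('X_1 * b + 'X_2 * c) ->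
  exists r be ga, c = 'X_1 * r + 'X_0 * ga /\ b = - ('X_2 * r) + 'X_0 * be.
Proof.
have X0 : ('X_0 : R) != 0 by rewrite -msupp_eq0 msuppX.
have X1 : ('X_1 : R) != 0 by rewrite -msupp_eq0 msuppX.
have [s [j [s0 nj sX hs]]] := linear_form_prime_subst (homogX 0) X0.
have ej : j = 0.
  by move: nj; rewrite mcoeffXU; case: (0 =P j) => [<- //|_]; rewrite eqxx.
have {nj ej} [sX1 sX2] : s 'X_1 = 'X_1 /\ s 'X_2 = 'X_2 by split; apply: sX; rewrite ej.
move=> [u eu].
have e0 : 'X_1 * s b + 'X_2 * s c = 0.
  by rewrite -{1}sX1 -{1}sX2 -!rmorphM -rmorphD eu rmorphM s0 mul0r.
have : divides 'X_1 ('X_2 * s c).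
  by exists (- s b); rewrite mulrN; apply/eqP; rewrite -addr_eq0 addrC e0.
case/(linear_form_prime (homogX 1) X1) => [/variable_divides_neq|] [] // r er.
have eb : s b = - ('X_2 * r).
  by apply: (mulfI X1); move/eqP: e0; rewrite er addr_eq0 => /eqP ->; ring.
have [be ebe] := hs b; have [ga ega] := hs c.
exists r, be, ga; split; first by rewrite -er -ega addrC subrK.
by rewrite -eb -ebe addrC subrK.
Qed.

Lemma koszul_exact (a b c : R) : 'X_0 * a + 'X_1 * b + 'X_2 * c = 0 ->
  exists p q r, [/\ a = 'X_1 * p + 'X_2 * q, b = - ('X_0 * p) + 'X_2 * r
                  & c = - ('X_0 * q) - 'X_1 * r].
Proof.
move=> e; have [|r [be [ga [ec eb]]]] := @koszul_two b c.
  by exists (- a); rewrite mulrN; apply/eqP; rewrite -addr_eq0 addrC addrA e.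
have X0 : ('X_0 : R) != 0 by rewrite -msupp_eq0 msuppX.
exists (- be), (- ga), (- r); split; rewrite ?ec ?eb; try by ring.
apply: (mulfI X0); apply/eqP; rewrite -subr_eq0 -e ec eb; apply/eqP; ring.
Qed.
Lemma homog_cofactor_ex n m l p : l \is m.-homog -> p \is (m + n).-homog ->
  divides l p -> exists2 t, t \is n.-homog & p = l * t.
Proof.
move=> hl hp [t ep]; exists (pihomog mdeg n t); first exact: pihomogP.
by rewrite -(pihomogM n t hl) -ep pihomog_dE.
Qed.
End Forms.

(** * Dimensions of spaces of forms *)

Section Lines.
Variables (F : fieldType) (V : vectType F).
Implicit Types (U : {vspace V}) (v w x : V).

Lemma dim_add_line U v : v \notin U -> (\dim U < \dim (U + <[v]>)%VS)%N.
Proof.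
move=> nv; rewrite ltnNge (geq_leqif (dimv_leqif_sup (addvSl U _))).
by apply: contra nv => /subvP; apply; apply/(subvP (addvSr _ _))/memv_line.
Qed.

Lemma codim2_decomp U v w x : (\dim {: V} = \dim U + 2)%N ->
  v \notin U -> w \notin (U + <[v]>)%VS ->
  exists u a b, u \in U /\ x = u + a *: v + b *: w.
Proof.
move=> dU /dim_add_line h1 /dim_add_line h2.
have : x \in (U + <[v]> + <[w]>)%VS.
  suff -> : (U + <[v]> + <[w]>)%VS = fullv by rewrite memvf.
  apply/eqP; rewrite eqEdim subvf /= dU addn2.
  exact: leq_ltn_trans h1 h2.
case/memv_addP=> y /memv_addP [u hu [_ /vlineP [a ->] ->]] [_ /vlineP [b ->] ->].
by exists u, a, b.
Qed.
End Lines.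

Section Dims.
Variable k : fieldType.
Local Notation R := {mpoly k[3]}.
Local Notation H := (dhomog 3 k).

(** Stated for twice the dimension C(n+2, 2), so that later counts are polynomial identities without
    division. *)
Lemma dim_forms n : (2 * \dim {: H n} = n.+1 * n.+2)%N.
Proof.
rewrite dimvf /dim /=.
have -> : 'C(n + 2, n) = 'C(n.+2, 2).
  by rewrite -(@bin_sub (n + 2) n) ?leq_addr // addKn addn2.
by rewrite -mul_bin_diag bin1 mulnC.
Qed.

(** The target degree is a separate index [N], so that multiples of forms of different degrees lie
    in one and the same space. *)
Definition mulh m n N (E : (m + n)%N = N) (a : H m) (p : H n) : H N :=
  DHomog (eq_rect _ (fun N => is_true (val a * val p \is N.-homog))
            (dhomogM (valP a) (valP p)) _ E).

Lemma mulh_linear m n N (E : (m + n)%N = N) (a : H m) : linear (mulh E a).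
Proof. by move=> c p q; apply: val_inj; rewrite /= mulrDr scalerAr. Qed.

HB.instance Definition _ m n N (E : (m + n)%N = N) (a : H m) :=
  GRing.isLinear.Build k (H n) (H N) _ (mulh E a) (mulh_linear E a).

(** Excluded middle either finds a form of [I] outside the current subspace, which then grows, or
    shows that the subspace is complete; the dimension of the whole space bounds the number of
    enlargements. *)
Lemma subspace_forms n (I : R -> Prop) :
  I 0 -> (forall p q, I p -> I q -> I (p + q)) -> (forall c p, I p -> I (c *: p)) ->
  exists U : {vspace H n}, forall p, p \in U <-> I (val p).
Proof.
move=> I0 ID IZ.
suff : forall j, (exists U : {vspace H n}, forall p, p \in U <-> I (val p)) \/
   exists2 U : {vspace H n}, (forall p, p \in U -> I (val p)) & (j <= \dim U)%N.
  move=> /(_ (\dim {: H n}).+1) [] // [U _ h].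
  by have := leq_trans h (dimvS (subvf U)); rewrite ltnn.
elim=> [|j [|[U hU dU]]]; [|by left|].
  by right; exists 0%VS => // p; rewrite memv0 => /eqP ->.
have [h|h] := excluded_middle_informative (forall p : H n, I (val p) -> p \in U).
  by left; exists U => p; split; [exact: hU | exact: h].
right; have [p hp] : exists p : H n, ~ (I (val p) -> p \in U) by apply: not_all_ex_not.
have [Ip nU] : I (val p) /\ ~ p \in U by tauto.
exists (U + <[p]>)%VS.
  move=> q /memv_addP [u uU [v /vlineP [c ->] ->]] /=.
  by apply: ID; [exact: hU | exact: IZ].
by apply: (leq_ltn_trans dU); apply: dim_add_line; apply/negP.
Qed.

Lemma mulh_inj m n N (E : (m + n)%N = N) (a : H m) : val a != 0 -> injective (mulh E a).
Proof. by move=> na p q /(congr1 val) /= /(mulfI na) /val_inj. Qed.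

Definition imgh m n N (E : (m + n)%N = N) (a : H m) : {vspace H N} :=
  limg (linfun (mulh E a)).

Lemma imghP m n N (E : (m + n)%N = N) (a : H m) (p : H N) :
  (p \in imgh E a) <-> divides (val a) (val p).
Proof.
split=> [/memv_imgP [q _ ->]|[t et]]; first by rewrite lfunE; exists (val q).
have [a0|na] := eqVneq (val a) 0.
  suff -> : p = 0 by rewrite mem0v.
  by apply: val_inj; rewrite et a0 mul0r.
have ht : t \is n.-homog.
  by apply: (homog_cofactor (valP a)) => //; rewrite -et E; apply: valP.
have -> : p = linfun (mulh E a) (DHomog ht) by apply: val_inj; rewrite lfunE.
exact/memv_img/memvf.
Qed.

Lemma dim_imgh m n N (E : (m + n)%N = N) (a : H m) : val a != 0 ->
  \dim (imgh E a) = \dim {: H n}.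
Proof.
move=> na; rewrite limg_dim_eq //; apply/eqP; rewrite -subv0 capfv; apply/subvP=> p.
rewrite memv_ker lfunE memv0 => /eqP e; apply/eqP; apply: (mulh_inj (E := E) na).
by rewrite linear0; exact: e.
Qed.

(** As l is prime and does not divide q, (l) and (q) meet in (lq), whose part of degree m+2 is a
    copy of R_(m-1). The case m = 0 is separate because it would need R_(-1). *)
Lemma dim_imgh_cap m (l : H 1) (q : H 2) : val l != 0 -> ~ divides (val l) (val q) ->
  (2 * \dim (imgh (erefl : 1 + m.+1 = m.+2)%N l :&: imgh (erefl : 2 + m = m.+2)%N q)
   = m * m.+1)%N.
Proof.
move=> nl ndq.
have nq : val q != 0 by apply/eqP => q0; apply: ndq; exists 0; rewrite q0 mulr0.
have prm b : divides (val l) (val q * b) -> divides (val l) b.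
  by case/(linear_form_prime (valP l) nl).
case: m => [|m].
  suff -> : (imgh (erefl : 1 + 1 = 2)%N l :&: imgh (erefl : 2 + 0 = 2)%N q)%VS = 0%VS.
    by rewrite dimv0.
  apply/eqP; rewrite -subv0; apply/subvP=> p.
  move=> /memv_capP [] /imghP dl /imghP [b eb]; rewrite memv0.
  have hb : b \is 0.-homog.
    by apply: (homog_cofactor (valP q)) => //; rewrite -eb; apply: valP.
  have [t et] : divides (val l) b by apply: prm; rewrite -eb.
  apply/eqP/val_inj; rewrite eb et (homog_cofactor_small (valP l) (n := 0)) ?mulr0 //.
  by rewrite -et.
pose ql := mulh (erefl : 2 + 1 = 3)%N q l.
have -> : (imgh (erefl : 1 + m.+2 = m.+3)%N l :&: imgh (erefl : 2 + m.+1 = m.+3)%N q)%VS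
   = imgh (erefl : 3 + m = m.+3)%N ql.
  apply/vspaceP=> p; apply/idP/idP.
    move=> /memv_capP [] /imghP dl /imghP [b eb]; apply/imghP.
    have [t et] : divides (val l) b by apply: prm; rewrite -eb.
    by exists t; rewrite eb et mulrA.
  move=> /imghP /= [t et]; apply/memv_capP; split; apply/imghP.
    by exists (val q * t); apply: (etrans et); ring.
  by exists (val l * t); apply: (etrans et); ring.
by rewrite dim_imgh ?dim_forms //= mulf_neq0.
Qed.

Definition ideal2 (l q p : R) : Prop := exists a b, p = l * a + q * b.

(** By the previous intersection the dimension of (l, q) in degree m+2 is dim R_(m+1) + dim R_m -
    dim R_(m-1), which is dim R_(m+2) - 2. *)
Lemma ideal2_space (l : H 1) (q : H 2) m (U : {vspace H m.+2}) :
  val l != 0 -> ~ divides (val l) (val q) ->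
  (forall p, p \in U <-> ideal2 (val l) (val q) (val p)) ->
  (\dim U + 2 = \dim {: H m.+2})%N.
Proof.
move=> nl ndq hU.
have nq : val q != 0 by apply/eqP => q0; apply: ndq; exists 0; rewrite q0 mulr0.
set A := imgh (erefl : 1 + m.+1 = m.+2)%N l.
set B := imgh (erefl : 2 + m = m.+2)%N q.
have -> : U = (A + B)%VS.
  apply/vspaceP=> p; apply/idP/idP.
    move=> /hU [a [b e]].
    have := congr1 (pihomog mdeg m.+2) e; rewrite pihomog_dE; last exact: valP.
    rewrite pihomogD (pihomogM m.+1 a (valP l) : pihomog mdeg m.+2 _ = _).
    rewrite (pihomogM m b (valP q) : pihomog mdeg m.+2 _ = _).
    move=> ep.
    have -> : p = mulh (erefl : 1 + m.+1 = m.+2)%N l (DHomog (pihomogP mdeg m.+1 a)) +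
                  mulh (erefl : 2 + m = m.+2)%N q (DHomog (pihomogP mdeg m b)).
      exact: val_inj.
    by apply: memv_add; apply/imghP; eexists; reflexivity.
  move=> /memv_addP [u /imghP [a ea] [v /imghP [b eb] ->]]; apply/hU.
  by exists a, b; rewrite /= ea eb.
have := dimv_sum_cap A B; have := dim_imgh_cap m nl ndq; rewrite -/A -/B.
rewrite !dim_imgh //; have := dim_forms m; have := dim_forms m.+1.
have := dim_forms m.+2.
nia.
Qed.

End Dims.

(** * Chains of primes and codimension *)

Section Chains.
Variables (k : fieldType) (N : nat).
Local Notation R := {mpoly k[3]}.

(** The value at the elements of [s] of the polynomial with all exponents below [N] whose
    coefficient at the exponent sequence [t] is [c t]. Peeling off one variable at a time matches
    the induction along a chain of primes. *)
Fixpoint poly_eval (s : seq R) (c : seq 'I_N -> k) : R :=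
  if s is a :: s' then \sum_(j < N) a ^+ j * poly_eval s' (fun t => c (j :: t))
  else (c [::])%:MP.

Lemma poly_eval_eq0 s c :
  (forall t, size t = size s -> c t = 0) -> poly_eval s c = 0.
Proof.
elim: s c => [|a s IH] c h /=; first by rewrite h.
by rewrite big1 // => j _; rewrite IH ?mulr0 // => t et; rewrite h //= et.
Qed.

Lemma poly_eval_ext s c1 c2 : c1 =1 c2 -> poly_eval s c1 = poly_eval s c2.
Proof.
elim: s c1 c2 => [|a s IH] c1 c2 h /=; first by rewrite h.
by apply: eq_bigr => j _; congr (_ * _); apply: IH => t; rewrite h.
Qed.

Lemma poly_eval_linear s b c1 c2 :
  poly_eval s (fun t => b * c1 t + c2 t) = b *: poly_eval s c1 + poly_eval s c2.
Proof.
elim: s c1 c2 => [|a s IH] c1 c2 /=; first by rewrite mpolyCD mpolyCM mul_mpolyC.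
rewrite scaler_sumr -big_split /=; apply: eq_bigr => j _.
by rewrite IH mulrDr scalerAr.
Qed.

Lemma msize_poly_eval r s c : (forall a, a \in s -> (msize a <= r.+1)%N) ->
  (msize (poly_eval s c) <= (size s * (N * r)).+1)%N.
Proof.
elim: s c => [|a s IH] c h /=; first by rewrite msizeC; case: (_ != _).
apply: (leq_trans (msize_sum _ _ _)); apply/bigmax_leqP => j _.
have ha : (msize a <= r.+1)%N by apply: h; rewrite inE eqxx.
have hD u v x y : (u <= x.+1 -> v <= y.+1 -> (u + v).-1 <= (x + y).+1)%N by lia.
have hM (p q : R) : (msize (p * q) <= (msize p + msize q).-1)%N.
  have [->|np] := eqVneq p 0; first by rewrite mul0r msize0.
  have [->|nq] := eqVneq q 0; first by rewrite mulr0 msize0.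
  by rewrite msizeM.
have hj i : (msize (a ^+ i) <= (i * r).+1)%N.
  elim: i => [|i IHi]; first by rewrite expr0 msize1.
  by rewrite exprS mulSn; apply: (leq_trans (hM _ _)); apply: hD.
have hs := IH (fun t => c (j :: t)) (fun b hb => h b (mem_behead (hb : b \in behead (a :: s)))).
apply: (leq_trans (hM _ _)); rewrite mulSn; apply: hD => //.
by apply: (leq_trans (hj j)); rewrite ltnS leq_mul2r ltnW ?orbT.
Qed.

(* With respect to the smallest exponent of the first element, the value is
   a^j (G + a (...)) with G in the next prime. *)
Lemma poly_eval_notin_chain s (P : nat -> R -> Prop) c :
  (forall i, (i <= size s)%N -> prime_ideal (P i)) ->
  (forall i, (i < size s)%N -> [/\ ideal_sub (P i) (P i.+1), P i.+1 s`_i & ~ P i s`_i]) ->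
  (exists2 t, size t = size s & c t != 0) -> ~ P 0%N (poly_eval s c).
Proof.
elim: s P c => [|a s IH] P c prP hP [t0 st0 nt0] /=.
  case: t0 st0 nt0 => // _ nc Pc.
  have [[[_ _ PM] P1] _] := prP 0%N isT; apply: P1.
  have -> : 1 = (c [::])^-1%:MP * (c [::])%:MP :> R by rewrite -mpolyCM mulVf // mpolyC1.
  exact: PM.
pose good (j : 'I_N) := [exists t : (size s).-tuple 'I_N, c (j :: t) != 0].
case: t0 st0 nt0 => // j0 t0 /= [st0] nt0.
have g0 : good j0.
  by apply/existsP; exists (@Tuple (size s) _ t0 (introT eqP st0)).
case: (@arg_minnP _ j0 good val g0) => j gj jmin.
set G := fun i : 'I_N => poly_eval s (fun t => c (i :: t)).
have low (i : 'I_N) : (i < j)%N -> G i = 0.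
  move=> ij; apply: poly_eval_eq0 => t st.
  apply/eqP; apply: contraLR ij => nc; rewrite -leqNgt; apply: jmin.
  by apply/existsP; exists (@Tuple (size s) _ t (introT eqP st)).
pose T := \sum_(i < N | (j < i)%N) a ^+ (i - j.+1) * G i.
have -> : \sum_(i < N) a ^+ i * G i = a ^+ j * (G j + a * T).
  rewrite (bigID (fun i : 'I_N => (i < j)%N)) /= big1 ?add0r; last first.
    by move=> i /low ->; rewrite mulr0.
  rewrite (bigD1 j) ?ltnn //= mulrDr; congr (_ + _).
  rewrite mulrA -exprSr mulr_sumr; apply: eq_big => i.
    by rewrite -leqNgt ltn_neqAle andbC eq_sym.
  by rewrite -leqNgt => /andP[h1 h2]; rewrite mulrA -exprD subnKC // ltn_neqAle eq_sym h2.
have [[idP0 _] prP0] := prP 0%N isT; have [sub01 P1a nP0a] := hP 0%N isT.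
have [[[_ P1D P1M] _] _] := prP 1%N isT.
case/prP0 => [|/sub01 h].
  have : forall i, P 0%N (a ^+ i) -> False; last by move=> h /h.
  elim=> [|i IHi]; first by have [[_ h] _] := prP 0%N isT; rewrite expr0.
  by rewrite exprS => /prP0 [].
have {h} : P 1%N (G j).
  have -> : G j = (G j + a * T) + (- T) * a by ring.
  by apply: P1D => //; apply: P1M.
apply: (IH (fun i => P i.+1)) => [i hi|i hi|]; [exact: prP | exact: (hP i.+1) |].
by have /existsP [t nt] := gj; exists t => //; rewrite size_tuple.
Qed.

End Chains.

Section Dependence.
Variable k : fieldType.
Local Notation R := {mpoly k[3]}.

(* Counting: the N^4 monomials of exponents < N in the a_i have degree O(N),
   hence lie in a space of dimension O(N^3). *)
Lemma algebraic_dependence (s : seq R) : size s = 4%N ->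
  exists N (c : seq 'I_N -> k),
    (exists2 t, size t = size s & c t != 0) /\ poly_eval s c = 0.
Proof.
move=> s4; pose r := (\max_(a <- s) msize a)%N.+1.
have hr a : a \in s -> (msize a <= r.+1)%N.
  by move=> ha; apply/leqW/leqW; rewrite (big_rem a) //= leq_maxl.
(* The values have degree at most 4Nr, so their exponents are below [D]. Since D <= 5Nr, there are
   at most 125 r^3 N^3 exponent vectors, fewer than the N^4 unknown coefficients for this [N]. *)
pose N := (125 * r ^ 3).+1; exists N.
pose D := (4 * (N * r)).+1.
pose T : finType := 4.-tuple 'I_N; pose E : finType := ('I_D * 'I_D * 'I_D)%type.
have cardTE : (#|E| < #|T|)%N.
  rewrite card_tuple !card_prod !card_ord.
  have h1 : (D <= 5 * (N * r))%N by rewrite /D /r /N; nia.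
  have : (D * D * D <= 125 * r ^ 3 * (N * N * N))%N.
    apply: (leq_trans (leq_mul (leq_mul h1 h1) h1)).
    by rewrite !expnS expn0; nia.
  move=> h; apply: (leq_ltn_trans h).
  rewrite (_ : (N ^ 4 = N * (N * N * N))%N); last by rewrite !expnS; lia.
  by rewrite ltn_pmul2r // !muln_gt0.
pose chi (u : 'rV[k]_#|T|) (t : seq 'I_N) : k :=
  if insub t : option T is Some t then u 0 (enum_rank t) else 0.
pose mon (i : E) : 'X_{1..3} := [multinom nth 0%N [:: val i.1.1; val i.1.2; val i.2] j | j < 3].
pose F (u : 'rV[k]_#|T|) : 'rV[k]_#|E| :=
  \row_i (poly_eval s (chi u))@_(mon (enum_val i)).
have Flin : linear F.
  move=> a u v; apply/rowP=> i; rewrite !mxE -mcoeffZ -mcoeffD -poly_eval_linear.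
  congr (_@_ _); apply: poly_eval_ext => t; rewrite /chi.
  by case: insub => [t'|]; rewrite ?mxE // mulr0 addr0.
pose FL := GRing.isLinear.Build _ _ _ _ F Flin.
pose Fl : {linear 'rV[k]_#|T| -> 'rV[k]_#|E|} := HB.pack F FL.
pose B := lin1_mx Fl.
have nzK : kermx B != 0.
  rewrite -mxrank_eq0 mxrank_ker subn_eq0 -ltnNge.
  exact: leq_ltn_trans (rank_leq_col _) cardTE.
pose u := nz_row (kermx B).
have Fu : F u = 0.
  have /sub_kermxP := nz_row_sub (kermx B); rewrite -/u /B => h.
  by rewrite -[F u]/(Fl u) -mul_rV_lin1.
exists (chi u); split.
  have nu : u != 0 by rewrite nz_row_eq0.
  have [i ni] : exists i, u 0 i != 0.
    apply/existsP; apply: contraNT nu; rewrite negb_exists => /forallP h.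
    by apply/eqP/rowP => i; rewrite mxE; apply/eqP; have := h i; rewrite negbK.
  exists (enum_val i : T); first by rewrite size_tuple s4.
  by rewrite /chi valK enum_valK.
apply/mpolyP=> m; rewrite mcoeff0.
have [hm|hm] := leqP (msize (poly_eval s (chi u))) (mdeg m).
  by apply/memN_msupp_eq0/msize_mdeg_ge.
have {}hm : (mdeg m < D)%N.
  by apply: (leq_trans hm); rewrite /D -s4; exact: msize_poly_eval.
have mi (i : 'I_3) : (m i < D)%N.
  by apply: leq_ltn_trans hm; rewrite mdegE (bigD1 i) //= leq_addr.
pose i : E := (Ordinal (mi 0), Ordinal (mi 1), Ordinal (mi 2)).
have := congr1 (fun v : 'rV_#|E| => v 0 (enum_rank i)) Fu.
rewrite !mxE enum_rankK => <-; congr (_@_ _).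
apply/mnmP=> j; rewrite mnmE /=.
by case: j => [[|[|[|]]]] //= hj; congr (m _); apply: val_inj.
Qed.

(** Elements a_i of P_(i+1) outside P_i satisfy a nontrivial polynomial relation, whose value 0 lies
    in P_0; along such a chain a nontrivial polynomial value never does. *)
Lemma no_chain_of_five (P : nat -> R -> Prop) :
  (forall i, (i <= 4)%N -> prime_ideal (P i)) ->
  (forall i, (i < 4)%N -> ideal_psub (P i) (P i.+1)) -> False.
Proof.
move=> prP hP.
have /all_sig [a ha] : forall i : 'I_4, {a | P i.+1 a /\ ~ P i a}.
  move=> i; apply: constructive_indefinite_description.
  have [_ nsub] := hP i (ltn_ord i).
  have [a ha] := not_all_ex_not _ _ nsub; exists a; tauto.
have [N [c [nc ev0]]] := @algebraic_dependence [:: a 0; a 1; a 2; a 3] erefl.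
apply: (@poly_eval_notin_chain _ _ [:: a 0; a 1; a 2; a 3] P c) => //; last first.
  by rewrite ev0; have [[[]]] := prP 0%N isT.
case=> [|[|[|[|]]]] // hi; split; try by case: (hP _ hi).
- by have [] := ha 0.
- by have [] := ha 0.
- by have [] := ha 1.
- by have [] := ha 1.
- by have [] := ha 2.
- by have [] := ha 2.
- by have [] := ha 3.
- by have [] := ha 3.
Qed.

End Dependence.

(** * The codimension of (l, q) *)

Section Kernels.
Variables (k : fieldType) (S : idomainType).
Local Notation R := {mpoly k[3]}.

Lemma kernel_prime (s : {rmorphism R -> S}) : prime_ideal (fun p => s p = 0).
Proof.
split; first split; first split.
- exact: rmorph0.
- by move=> p q hp hq; rewrite rmorphD hp hq addr0.
- by move=> a p hp; rewrite rmorphM hp mulr0.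
- by move/eqP; rewrite rmorph1 oner_eq0.
by move=> p q /eqP; rewrite rmorphM mulf_eq0 => /orP[] /eqP; [left|right].
Qed.
End Kernels.

Section Codim.
Variable k : closedFieldType.
Local Notation R := {mpoly k[3]}.

Lemma divides_prime (l : R) : l \is 1.-homog -> l != 0 -> prime_ideal (divides l).
Proof.
move=> hl nl; split; last by move=> p q; apply: linear_form_prime.
split; first split.
- by exists 0; rewrite mulr0.
- by move=> p q [a ->] [b ->]; exists (a + b); rewrite mulrDr.
- by move=> a p [b ->]; exists (a * b); rewrite mulrCA.
case=> t e; have := homog_cofactor_small hl (n := 0) (t := t) isT.
by rewrite -e => /(_ (dhomog1 _ _)) /eqP; rewrite oner_eq0.
Qed.

(** Restriction to the line through the origin spanned by [v]; for nonzero [v] the kernel is the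
    homogeneous prime of the projective point [v]. *)
Definition line (v : 'I_3 -> k) : {rmorphism R -> {poly k}} :=
  mmap polyC (fun i => v i *: 'X).

Lemma lineX v i : line v 'X_i = v i *: 'X.
Proof. by rewrite /line /= mmapX mmap1U. Qed.

Lemma line_form v n p : p \is n.-homog -> line v p = p.@[v] *: 'X^n.
Proof.
move=> /dhomogP hp; rewrite /line /= /mmap mevalE scaler_suml !big_seq.
apply: eq_bigr => m hm; rewrite -(hp m hm) /mmap1 mul_polyC -scalerA; congr (_ *: _).
rewrite (eq_bigr (fun i => v i ^+ m i *: 'X^(m i))) => [|i _]; last by rewrite exprZn.
rewrite scaler_prod -expr_sum; congr (_ *: 'X^_); exact: esym (mdegE m).
Qed.

Lemma horner_line v p x : (line v p).[x] = p.@[fun i => v i * x].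
Proof.
rewrite /line /= /mmap mevalE horner_sum; apply: eq_bigr => m _.
rewrite hornerCM horner_prod; congr (_ * _); apply: eq_bigr => i _.
by rewrite horner_exp hornerZ hornerX.
Qed.

(** The plane l = 0 has a basis u, w. If q(w) = 0, take w; otherwise q(u + x w) is a polynomial in x
    of degree two with leading coefficient q(w), and it has a root as k is algebraically closed. *)
Lemma common_zero (l q : R) : l \is 1.-homog -> q \is 2.-homog -> l != 0 ->
  exists v : 'I_3 -> k, [/\ exists i, v i != 0, l.@[v] = 0 & q.@[v] = 0].
Proof.
move=> hl hq nl.
have [s [j [_ cj _ _]]] := linear_form_prime_subst hl nl.
set c := fun i => l@_U_(i)%MM; rewrite -/(c j) in cj.
have le v : l.@[v] = \sum_i c i * v i.
  rewrite {1}(linear_form_eval hl) raddf_sum; apply: eq_bigr => i _.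
  by rewrite /= mevalM mevalC mevalXU.
have [i1 [i2 [n1 n2 n12]]] : exists i1 i2 : 'I_3, [/\ i1 != j, i2 != j & i1 != i2].
  by exists (j + 1), (j + 1 + 1); case: j {cj} => [[|[|[|]]]] //.
pose e i : 'I_3 -> k := fun a => (a == i)%:R - (a == j)%:R * (c i / c j).
have le0 i : i != j -> l.@[e i] = 0.
  move=> ni; rewrite le /e; under eq_bigr do rewrite mulrBr.
  rewrite big_split /= (bigD1 i) //= eqxx mulr1 big1 ?addr0; last first.
    by move=> a /negbTE ->; rewrite mulr0.
  rewrite (bigD1 j) //= eqxx mul1r big1 ?addr0; last first.
    by move=> a /negbTE ->; rewrite mul0r mulr0 oppr0.
  by rewrite mulrC divfK // subrr.
have lin (u w : 'I_3 -> k) (m : R) x : m \is 1.-homog -> m.@[fun i => u i + w i * x] = m.@[u] + m.@[w] * x.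
  move=> /linear_form_eval ->; rewrite !raddf_sum /= mulr_suml -big_split /=.
  by apply: eq_bigr => i _; rewrite !mevalM !mevalC !mevalXU mulrDr mulrA.
set u := e i1; set w := e i2.
have [m [hm eq]] := form_decomp hq.
have qe v : q.@[v] = \sum_i v i * (m i).@[v].
  by rewrite {1}eq raddf_sum; apply: eq_bigr => i _; rewrite /= mevalM mevalXU.
have [qw|qw] := eqVneq q.@[w] 0.
  exists w; split=> //; last exact: le0.
  by exists i2; rewrite /w /e eqxx (negbTE n2) mul0r subr0 oner_eq0.
pose g : {poly k} := \sum_i ((u i)%:P + w i *: 'X) * (((m i).@[u])%:P + (m i).@[w] *: 'X).
have gE x : g.[x] = q.@[fun i => u i + w i * x].
  rewrite qe horner_sum; apply: eq_bigr => i _.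
  by rewrite lin // hornerM !hornerD !hornerC !hornerZ !hornerX.
have g2 : g`_2 = q.@[w].
  rewrite qe coef_sum; apply: eq_bigr => i _.
  have -> (a b c' d : k) : (a%:P + b *: 'X) * (c'%:P + d *: 'X) =
      (a * c')%:P + (a * d + b * c') *: 'X + (b * d) *: 'X^2.
    by rewrite -!mul_polyC !(polyCM, polyCD); ring.
  by rewrite !coefD coefC !coefZ coefX coefXn mulr0 !add0r mulr1.
have /closed_rootP [x] : size g != 1%N.
  apply/eqP=> sg; move: qw; rewrite -g2 nth_default ?eqxx //.
  by rewrite sg.
rewrite /root gE => /eqP qx.
exists (fun i => u i + w i * x); split=> //.
  exists i1; rewrite /u /w /e eqxx (negbTE n1) (negbTE n12) !mul0r !subr0 mul0r addr0.
  exact: oner_neq0.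
by rewrite lin // !le0 // mul0r addr0.
Qed.

(** A prime P over (l, q) sits on top of 0 < (l) < P. For the upper bound, the prime of a common
    zero is strictly contained in the maximal ideal of the origin, so height three would give a
    chain of five primes. *)
Lemma ideal2_codim (l q : R) : l \is 1.-homog -> q \is 2.-homog -> l != 0 ->
  ~ divides l q -> codim (ideal2 l q) 2.
Proof.
move=> hl hq nl ndq; split.
  move=> P prP sub.
  exists (fun i => match i with 0%N => fun p => p = 0 | 1%N => divides l | _ => P end).
  split=> //.
  - case=> [|[|[|]]] // _; first exact: (kernel_prime (GRing.RMorphism.clone _ _ idfun _)).
    exact: divides_prime.
  - case=> [|[|]] // _; split.
    + by move=> p ->; exists 0; rewrite mulr0.
    + move=> /(_ l) h; move/eqP: nl; apply; apply: h; exists 1; exact: esym (mulr1 _).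
    + by move=> p [t ->]; apply: sub; exists t, 0; rewrite mulr0 addr0.
    + by move=> h; apply/ndq/h/sub; exists 0, 1; rewrite mulr0 mulr1 add0r.
have [v [[i vi] lv qv]] := common_zero hl hq nl.
exists (fun p => line v p = 0); split; first exact: kernel_prime.
  move=> p [a [b ->]]; rewrite rmorphD !rmorphM (line_form v hl) (line_form v hq) lv qv.
  by rewrite !scale0r !mul0r addr0.
move=> [c [prc hc ec]].
apply: (@no_chain_of_five k
  (fun i => if (i <= 3)%N then c i else fun p => p.@[fun=> 0] = 0)).
  move=> j hj; case: (leqP j 3) => [/prc //|_].
  exact: (kernel_prime (meval (fun=> 0))).
move=> j hj; rewrite -ltnS hj; case: (leqP j.+1 3) => [/hc //|h3].
have -> : j = 3%N by lia.
split=> [p /ec hp|].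
  have := horner_line v p 0; rewrite hp horner0 => h0; rewrite [in RHS]h0.
  by apply: meval_eq => a; rewrite mulr0.
move=> /(_ 'X_i); rewrite mevalXU => /(_ erefl) /ec; rewrite lineX => /eqP.
by rewrite scaler_eq0 polyX_eq0 (negbTE vi).
Qed.

End Codim.

(** * The ideal cut out by a map with kernel R eps *)

Section Syzygies.
Variables (k : fieldType) (f : {mpoly k[3]}).
Local Notation R := {mpoly k[3]}.
Implicit Types (v w : Syz f).

Lemma syz_eqP v w : (forall i, syz_val v 0 i = syz_val w 0 i) -> v = w.
Proof. by move=> h; apply/val_inj/rowP. Qed.

Lemma syz_rel v : \sum_(i < 3) syz_val v 0 i * f^`M(i) = 0.
Proof. exact/eqP/(valP v). Qed.

Lemma syz_valZ a v i : syz_val (a *: v) 0 i = a * syz_val v 0 i.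
Proof. by rewrite -[syz_val (a *: v)]/(a *: syz_val v) mxE. Qed.

Lemma syz_valD v w i : syz_val (v + w) 0 i = syz_val v 0 i + syz_val w 0 i.
Proof. by rewrite -[syz_val (v + w)]/(syz_val v + syz_val w) mxE. Qed.

Lemma syz_valN v i : syz_val (- v) 0 i = - syz_val v 0 i.
Proof. by rewrite -[syz_val (- v)]/(- syz_val v) mxE. Qed.

Lemma syz_val0 i : syz_val (0 : Syz f) 0 i = 0.
Proof. by rewrite -[syz_val (0 : Syz f)]/(0 : 'rV_3) mxE. Qed.

Lemma syz_val_combB a b v w i :
  syz_val (a *: v - b *: w) 0 i = a * syz_val v 0 i - b * syz_val w 0 i.
Proof. by rewrite (syz_valD (a *: v)) (syz_valN (b *: w)) (syz_valZ a) (syz_valZ b). Qed.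

Lemma syz_val_comb3 a b c u v w i : syz_val (a *: u + b *: v + c *: w) 0 i =
  a * syz_val u 0 i + b * syz_val v 0 i + c * syz_val w 0 i.
Proof.
by rewrite (syz_valD (a *: u + _)) (syz_valD (a *: u)) (syz_valZ a) (syz_valZ b) (syz_valZ c).
Qed.

Definition syz_valE := (syz_valZ, syz_valD, syz_valN, syz_val0).

Lemma syz_neq0 v : v != 0 -> exists i, syz_val v 0 i != 0.
Proof.
move=> nv; apply/existsP; apply: contraNT nv; rewrite negb_exists => /forallP h.
by apply/eqP/syz_eqP => i; rewrite syz_val0; apply/eqP; have := h i; rewrite negbK.
Qed.

Lemma syz_scaler_inj a v : v != 0 -> a *: v = 0 -> a = 0.
Proof.
move=> /syz_neq0 [i ni] /(congr1 (fun u => syz_val u 0 i)); rewrite !syz_valE.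
by move/eqP; rewrite mulf_eq0 (negbTE ni) orbF => /eqP.
Qed.

Lemma syz_scaler_inj0 (a : R) v : a != 0 -> a *: v = 0 -> v = 0.
Proof.
move=> na av; apply/eqP; apply: contraNT na => nv.
by apply/eqP/(syz_scaler_inj nv).
Qed.

Lemma syz_divide (a : R) (u : 'I_3 -> R) v : a != 0 ->
  (forall i, syz_val v 0 i = a * u i) -> exists w, v = a *: w.
Proof.
move=> na h.
have hu : (\row_i u i) \in syz_pred f.
  apply/eqP/(mulfI na); rewrite mulr0; apply: etrans (syz_rel v); rewrite mulr_sumr.
  by apply: eq_bigr => i _; rewrite mxE h mulrA.
by exists (MkSyz hu); apply: syz_eqP => i; rewrite syz_valZ h /= mxE.
Qed.

Section Image.
Variables (eps : Syz f) (phi : {linear Syz f -> R^o}).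
Hypothesis eps_neq0 : eps != 0.
Hypothesis ker_phi : forall v, phi v = 0 <-> exists a : R, v = a *: eps.

Lemma phiZ (a : R) v : phi (a *: v) = a * phi v.
Proof. by rewrite linearZ. Qed.

(* The lifts v_i of X_i s satisfy X_j v_i - X_i v_j = c_ij eps for a Koszul
   cocycle c, which is a coboundary b; then v_0 - b_0 eps is divisible by X_0. *)
Lemma image_saturated (s : R) :
  (forall i, exists v, phi v = 'X_i * s) -> exists v, phi v = s.
Proof.
move=> h; have [v0 e0] := h 0; have [v1 e1] := h 1; have [v2 e2] := h 2.
have rel i j vi vj : phi vi = 'X_i * s -> phi vj = 'X_j * s ->
    exists c : R, 'X_j *: vi - 'X_i *: vj = c *: eps.
  by move=> ei ej; apply/ker_phi; rewrite linearB !phiZ ei ej mulrCA subrr.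
have [c01 E01] := rel _ _ _ _ e0 e1.
have [c02 E02] := rel _ _ _ _ e0 e2.
have [c12 E12] := rel _ _ _ _ e1 e2.
have cocycle : 'X_0 * c12 + 'X_1 * (- c02) + 'X_2 * c01 = 0.
  apply: (@syz_scaler_inj _ _ eps_neq0).
  rewrite !scalerDl -!scalerA scaleNr -E01 -E02 -E12; apply: syz_eqP => i.
  rewrite !syz_valE; move: (syz_val v0 0 i) (syz_val v1 0 i) (syz_val v2 0 i) => a0 a1 a2.
  by move: ('X_0 : R) ('X_1 : R) ('X_2 : R); clear => x0 x1 x2; ring.
have [p [q [r [_ _ ec01]]]] := koszul_exact cocycle.
have X0 : ('X_0 : R) != 0 by rewrite -msupp_eq0 msuppX.
pose w0 := v0 + r *: eps; pose w1 := v1 - q *: eps.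
have ew : 'X_1 *: w0 = 'X_0 *: w1.
  apply/eqP; rewrite -subr_eq0; apply/eqP.
  have -> : 'X_1 *: w0 - 'X_0 *: w1 = ('X_1 *: v0 - 'X_0 *: v1) - c01 *: eps.
    rewrite ec01 scalerDr scalerBr !scalerA opprB scalerBl scaleNr opprB opprK.
    by rewrite [_ - 'X_0 *: v1]addrC addrACA.
  by rewrite E01 subrr.
have /all_sig [u hu] : forall i, {t | syz_val w0 0 i = 'X_0 * t}.
  move=> i; apply: constructive_indefinite_description.
  have : divides 'X_0 ('X_1 * syz_val w0 0 i).
    by exists (syz_val w1 0 i); rewrite -!syz_valZ ew.
  by case/(linear_form_prime (homogX _ 0) X0) => // /variable_divides_neq [].
have [w ewX] := syz_divide X0 hu; exists w.
apply: (mulfI X0); rewrite -phiZ -ewX linearD phiZ e0.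
have -> : phi eps = 0 by apply/ker_phi; exists 1; rewrite scale1r.
by rewrite mulr0 addr0.
Qed.

End Image.
End Syzygies.

(** * Saturated ideals of multiplicity two *)

Section Saturated.
Variable k : fieldType.
Local Notation R := {mpoly k[3]}.
Local Notation H := (dhomog 3 k).
Variables (I : R -> Prop) (U : forall n, {vspace H n}) (N : nat).
Hypothesis I_homog : homogeneous_ideal I.
Hypothesis I_neq1 : ~ I 1.
Hypothesis I_sat : forall s, (forall i, I ('X_i * s)) -> I s.
Hypothesis U_mem : forall n p, p \in U n <-> I (val p).
Hypothesis U_codim : forall n, (N <= n)%N -> (\dim {: H n} = \dim (U n) + 2)%N.

Let I0 : I 0. Proof. by have [[]] := I_homog. Qed.
Let ID p q : I p -> I q -> I (p + q). Proof. by have [[_ h _] _] := I_homog; apply: h. Qed.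
Let IM a p : I p -> I (a * p). Proof. by have [[_ _ h] _] := I_homog; apply: h. Qed.
Let IZ (c : k) p : I p -> I (c *: p). Proof. by rewrite -mul_mpolyC; apply: IM. Qed.
Let IB p q : I p -> I q -> I (p - q).
Proof. by move=> hp hq; apply: ID => //; rewrite -mulN1r; apply: IM. Qed.
Let Isum n (F : 'I_n -> R) : (forall i, I (F i)) -> I (\sum_i F i).
Proof. by move=> h; apply: (big_ind I). Qed.
Let Ieq p q : I p -> p = q -> I q. Proof. by move=> h <-. Qed.

Let var (i : 'I_3) : H 1 := DHomog (homogX k i).

(* A linear space of 2 x 2 matrices of rank <= 1 has a common kernel or a common
   image; multiplication by R_1 on (R/I)_N has neither, by saturation and by
   generation in degree 0. *)
Lemma regular_form_at : exists h : H 1, forall s : H N, I (val h * val s) -> I (val s).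
Proof.
have [//|nog] := excluded_middle_informative
  (exists h : H 1, forall s : H N, I (val h * val s) -> I (val s)).
exfalso; have {}nog (g : H 1) : exists s : H N, I (val g * val s) /\ ~ I (val s).
  apply: NNPP => h; apply: nog; exists g => s Is; apply: NNPP => ns.
  by apply: h; exists s.
have gen (L : R -> Prop) : L 0 -> (forall p q, L p -> L q -> L (p + q)) ->
    (forall i (r : H N), L ('X_i * val r)) -> forall p : H N.+1, L (val p).
  move=> L0 LD LX p; have [q [hq ->]] := form_decomp (valP p).
  by apply: (big_ind L) => // i _; apply: (LX i (DHomog (hq i))).
have [i [t nt]] : exists i (t : H N), ~ I ('X_i * val t).
  apply: NNPP => h; have full : U N.+1 = fullv.
    apply/vspaceP => p; rewrite memvf; apply/U_mem; apply: gen => // i r.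
    by apply: NNPP => nr; apply: h; exists i, r.
  by have := U_codim (leqnSn N); rewrite full; lia.
(* Modulo I, [h] kills s but not t, so s and t form a basis of (R/I)_N. *)
pose h := var i; have [s [hs ns]] := nog h.
have decomp (r : H N) : exists (u : H N) a b, I (val u) /\
    val r = val u + a *: val s + b *: val t.
  have [||u [a [b [/U_mem hu ->]]]] := @codim2_decomp _ _ (U N) s t r (U_codim (leqnn N)).
  - by apply/negP => /U_mem.
  - apply/negP => /memv_addP [u /U_mem hu [_ /vlineP [c ->] et]]; apply: nt.
    rewrite et /= mulrDr -scalerAr; apply: ID; first exact: IM.
    exact: IZ.
  by exists u, a, b.
(* Some r outside I is killed by g. Its t-coefficient cannot vanish, since gs is not in I; hence gt
   is a multiple of gs modulo I. *)
have prop (g : H 1) : ~ I (val g * val s) ->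
    exists c : k, I (val g * val t - c *: (val g * val s)).
  move=> ngs; have [r [Igr nr]] := nog g; have [u [a [b [Iu er]]]] := decomp r.
  have [b0|nb] := eqVneq b 0.
    have [a0|na] := eqVneq a 0.
      by case: nr; rewrite er a0 b0 !scale0r !addr0.
    case: ngs; apply: (Ieq (IZ a^-1 (IB Igr (IM (val g) Iu)))).
    rewrite er b0 scale0r addr0 mulrDr addrAC subrr add0r -scalerAr scalerA.
    by rewrite mulVf // scale1r.
  exists (- (a / b)); apply: (Ieq (IZ b^-1 (IB Igr (IM (val g) Iu)))).
  have eb : (b^-1)%:MP * b%:MP = 1 :> R by rewrite -mpolyCM mulVf // mpolyC1.
  rewrite er -!mul_mpolyC mpolyCN mpolyCM -[val g * val t in RHS]mul1r -eb.
  by ring.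
(* [L] is I plus the line of ht. It turns out to contain all of R_(N+1), against codimension two. *)
pose L p := exists a : k, I (p - a *: (val h * val t)).
have LD p q : L p -> L q -> L (p + q).
  move=> [a ha] [b hb]; exists (a + b); apply: (Ieq (ID ha hb)).
  by rewrite scalerDl opprD addrACA.
have LI p : I p -> L p by exists 0; rewrite scale0r subr0.
have LZ c p : L p -> L (c *: p).
  by move=> [a ha]; exists (c * a); have := IZ c ha; rewrite scalerBr scalerA.
have LB p q : L p -> L q -> L (p - q).
  by move=> hp hq; apply: LD => //; rewrite -scaleN1r; apply: LZ.
have L1 (g : H 1) : ~ I (val g * val s) -> L (val g * val s) /\ L (val g * val t).
  move=> ngs; have [c Ic] := prop g ngs.
  (* As hs lies in I, comparing [prop] for g and for g + h shows that ht is a multiple of gs modulo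
     I, with a nonzero factor because ht is not in I. *)
  have [|c' Ic'] := prop (g + h).
    by move=> hh; apply: ngs; have := IB hh hs; rewrite /= mulrDl addrK.
  have Iht : I (val h * val t - (c' - c) *: (val g * val s)).
    apply: (Ieq (ID (IB Ic' Ic) (IZ c' hs))).
    by rewrite /= -!mul_mpolyC rmorphB; ring.
  have ncc : c' - c != 0.
    by apply/eqP=> c0; apply: nt; move: Iht; rewrite c0 scale0r subr0.
  have Lgs : L (val g * val s).
    exists (c' - c)^-1; apply: (Ieq (IZ (- (c' - c)^-1) Iht)).
    by rewrite scalerBr scalerA mulNr mulVf // !scaleNr scale1r opprK addrC.
  split=> //; rewrite -[X in L X](subrK (c *: (val g * val s))).
  by apply: LD; [exact: LI | exact: LZ].
have [j nj] : exists j, ~ I ('X_j * val s).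
  by apply: not_all_ex_not => hj; apply/ns/I_sat.
have L2 (g : H 1) : L (val g * val s) /\ L (val g * val t).
  have [Igs|/L1 //] := excluded_middle_informative (I (val g * val s)).
  split; first exact: LI.
  have [_ Lj] := L1 (var j) nj.
  have [|_ Lgj] := L1 (g + var j).
    by move=> hh; apply: nj; have := IB hh Igs; rewrite /= mulrDl addrAC subrr add0r.
  by have := LB _ _ Lgj Lj; rewrite /= mulrDl addrK.
have Lall : forall p : H N.+1, L (val p).
  apply: gen => //; first exact: LI.
  move=> a r; have [u [x [y [Iu ->]]]] := decomp r; have [La Lb] := L2 (var a).
  by rewrite !mulrDr -!scalerAr; apply/LD/LZ/Lb/LD/LZ/La/LI/IM.
pose ht := mulh (erefl : 1 + N = N.+1)%N h t.
have full : (U N.+1 + <[ht]>)%VS = fullv.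
  apply/vspaceP => p; rewrite memvf; have [c hc] := Lall p.
  rewrite -[p](subrK (c *: ht)); apply: memv_add; last exact/memvZ/memv_line.
  exact/U_mem.
have := dimv_add_leqif (U N.+1) <[ht]>%VS; rewrite full => -[+ _].
rewrite dim_vline (U_codim (leqnSn N)) leq_add2l.
by case: (_ != _).
Qed.

Section RegularForm.
Variable h : H 1.

(** This and the next predicate are injectivity and surjectivity of multiplication by [h] from
    (R/I)_n to (R/I)_(n+1). *)
Definition regular_at n := forall s : H n, I (val h * val s) -> I (val s).
Definition spans_at n := forall p : H n.+1, exists s : H n, I (val p - val h * val s).

(** Surjectivity moves upwards because R_(n+2) = R_1 R_(n+1). *)
Lemma spansS n : spans_at n -> spans_at n.+1.
Proof.
move=> sp p; have [q [hq ep]] := form_decomp (valP p).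
have /all_sig [s hs] : forall i, {s : H n | I (q i - val h * val s)}.
  by move=> i; apply: constructive_indefinite_description; apply: (sp (DHomog (hq i))).
have hS : \sum_i 'X_i * val (s i) \is n.+1.-homog.
  by apply: rpred_sum => i _; exact: (dhomogM (homogX k i) (valP (s i))).
exists (DHomog hS); rewrite [val p]ep /= mulr_sumr -sumrB; apply: Isum => i.
by rewrite mulrCA -mulrBr; apply: IM.
Qed.

(** Injectivity moves downwards by saturation: if hs lies in I, so does each h X_i s. *)
Lemma regularP n : regular_at n.+1 -> regular_at n.
Proof.
move=> reg s hs; apply: I_sat => i.
by apply: (reg (mulh (erefl : 1 + n = n.+1)%N (var i) s)); rewrite /= mulrCA; apply: IM.
Qed.

Let A n : {vspace H n.+1} := imgh (erefl : 1 + n = n.+1)%N h.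

Lemma spans_atP n : spans_at n <-> (A n + U n.+1)%VS = fullv.
Proof.
split=> [sp|e p].
  apply/vspaceP => p; rewrite memvf; have [s hs] := sp p.
  rewrite -[p](subrK (mulh (erefl : 1 + n = n.+1)%N h s)) addrC; apply: memv_add.
    by apply/imghP; exists (val s).
  exact/U_mem.
have := memvf p; rewrite -e => /memv_addP [u /imghP du [v /U_mem hv ep]].
have [t ht et] := homog_cofactor_ex (n := n) (valP h) (valP u) du.
exists (DHomog ht); apply: (Ieq hv); rewrite /= -et.
by apply/eqP; rewrite eq_sym subr_eq addrC; apply/eqP; exact: (congr1 val ep).
Qed.

Hypothesis h_neq0 : val h != 0.

(** Rank-nullity for multiplication by [h], which is injective on R_n: [P] is the degree n part of
    (I : h), and its image is the intersection of hR_n with I_(n+1). *)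
Lemma dim_regular n : let P := (linfun (mulh (erefl : 1 + n = n.+1)%N h) @^-1: U n.+1)%VS in
  [/\ (\dim (A n + U n.+1) + \dim P = \dim {: H n} + \dim (U n.+1))%N,
      (U n <= P)%VS & (P <= U n)%VS <-> regular_at n].
Proof.
set mh := mulh _ h; move=> P; split.
- rewrite -(dim_imgh (erefl : 1 + n = n.+1)%N h_neq0) -dimv_sum_cap; congr addn.
  have <- : (linfun mh @: P)%VS = (A n :&: U n.+1)%VS.
    by rewrite /P -lpreim_cap_limg lpreimK ?capvSr // capvC.
  rewrite limg_dim_eq //; apply/eqP; rewrite -subv0; apply/subvP=> p /memv_capP [_].
  rewrite memv_ker lfunE memv0 => /eqP e; apply/eqP.
  apply: (@mulh_inj _ _ _ _ (erefl : 1 + n = n.+1)%N h h_neq0).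
  by rewrite linear0; exact: e.
- apply/subvP=> p /U_mem hp; rewrite -memv_preim lfunE; apply/U_mem.
  exact: (IM (val h) hp).
- split=> [/subvP sub s hs|reg].
    by apply/U_mem/sub; rewrite -memv_preim lfunE; apply/U_mem.
  apply/subvP=> p; rewrite -memv_preim lfunE => /U_mem hp.
  exact/U_mem/reg.
Qed.

(** Here [a] and [c] are the dimensions of hR_n + I_(n+1) and of (I : h)_n; in this form all
    comparisons are linear arithmetic. *)
Lemma regular_dims n : exists a c,
  [/\ (a + c = \dim {: H n} + \dim (U n.+1))%N, (\dim (U n) <= c)%N,
      (a <= \dim {: H n.+1})%N, (c <= \dim (U n))%N <-> regular_at n
    & (\dim {: H n.+1} <= a)%N <-> spans_at n].
Proof.
have [e sub reg] := dim_regular n.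
eexists; eexists; split; [exact: e|exact: dimvS|exact/dimvS/subvf| |].
  rewrite -reg; split=> [le|/dimvS //].
  suff /eqP {1}<- : U n == (linfun (mulh (erefl : 1 + n = n.+1)%N h) @^-1: U n.+1)%VS.
    exact: subvv.
  by rewrite eqEdim sub.
rewrite spans_atP; split=> [le|->] //.
by apply/eqP; rewrite eqEdim subvf.
Qed.

End RegularForm.

(** Regularity in degree N gives surjectivity there, as both dimensions are 2; surjectivity goes up,
    hence so does regularity, and regularity also goes down. So the Hilbert function of R/I is
    nondecreasing, and where it fails to grow it is constant from then on. It starts at 1 and ends
    at 2, so it cannot stay at 1 in degree 1. *)
Lemma codim_values :
  (\dim {: H 0} = \dim (U 0) + 1)%N /\
  forall n, (0 < n)%N -> (\dim {: H n} = \dim (U n) + 2)%N.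
Proof.
have [h hreg] := regular_form_at.
have nh : val h != 0.
  apply/eqP => h0; have full : U N = fullv.
    apply/vspaceP => p; rewrite memvf; apply/U_mem/hreg.
    by rewrite h0 mul0r.
  by have := U_codim (leqnn N); rewrite full; lia.
have dims := regular_dims nh.
have reg_spans n : (N <= n)%N -> regular_at h n -> spans_at h n.
  move=> hn reg; have [a [c [e1 e2 e3 [_ /(_ reg) e4] [e5 _]]]] := dims n.
  apply: e5; have := U_codim hn; have := U_codim (leqW hn); lia.
have spans_reg n : (N <= n)%N -> spans_at h n -> regular_at h n.
  move=> hn sp; have [a [c [e1 e2 e3 [e4 _] [_ /(_ sp) e5]]]] := dims n.
  apply: e4; have := U_codim hn; have := U_codim (leqW hn); lia.
have spans_up n : spans_at h n -> forall j, spans_at h (j + n).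
  by move=> sp; elim=> // j IH; apply: spansS.
have reg_up j : regular_at h (j + N).
  by apply: spans_reg; [exact: leq_addl | apply/spans_up/reg_spans].
have reg n : regular_at h n.
  have down j : regular_at h (j + n) -> regular_at h n by elim: j => // j IH /regularP.
  by apply: (down N); rewrite addnC.
have mono n : (\dim {: H n} + \dim (U n.+1) <= \dim {: H n.+1} + \dim (U n))%N.
  by have [a [c [e1 e2 e3 [_ /(_ (reg n)) e4] _]]] := dims n; lia.
have const n : spans_at h n ->
    (\dim {: H n} + \dim (U n.+1) = \dim {: H n.+1} + \dim (U n))%N.
  move=> sp.
  by have [a [c [e1 e2 e3 [_ /(_ (reg n)) e4] [_ /(_ sp) e5]]]] := dims n; lia.
have strict n : (\dim {: H n} + \dim (U n.+1) >= \dim {: H n.+1} + \dim (U n))%N ->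
    spans_at h n.
  by have [a [c [e1 e2 e3 [_ /(_ (reg n)) e4] [e5 _]]]] := dims n => le; apply: e5; lia.
have d0 : (\dim {: H 0} = \dim (U 0) + 1)%N.
  have -> : U 0 = 0%VS.
    apply/eqP; rewrite -subv0; apply/subvP=> p /U_mem; rewrite memv0.
    have := homog0_const (valP p); set c := (val p)@_0%MM => ep.
    have [c0 _|nc Ip] := eqVneq c 0.
      by apply/eqP/val_inj; rewrite ep c0 mpolyC0.
    case: I_neq1; apply: (Ieq (IZ c^-1 Ip)).
    by rewrite ep -mul_mpolyC -mpolyCM mulVf // mpolyC1.
  by have := dim_forms k 0; rewrite dimv0; lia.
have d1 : (\dim {: H 1} >= \dim (U 1) + 2)%N.
  rewrite leqNgt; apply/negP => lt.
  have /spans_up sp : spans_at h 0 by apply: strict; lia.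
  have c1 j : (\dim {: H j} = \dim (U j) + 1)%N.
    by elim: j => // j IH; have := const j; have := sp j; rewrite addn0 => h1 /(_ h1); lia.
  by have := U_codim (leqnn N); have := c1 N; lia.
split=> // n n0; apply/eqP; rewrite eqn_leq; apply/andP; split; last first.
  elim: n n0 => // -[|n] IH _ //; have := IH isT; have := mono n.+1; lia.
have up j : (\dim {: H n} + \dim (U (j + n)) <= \dim {: H (j + n)} + \dim (U n))%N.
  by elim: j => // j IH; have := mono (j + n)%N; rewrite addSn; lia.
have := up N; have := U_codim (leq_addr n N); lia.
Qed.

(** I_1 has dimension 3 - 2 = 1 and gives l; I_2 has dimension 6 - 2 = 4, more than the 3 of lR_1,
    and gives q. From degree 2 on, (l, q) lies in I and has the same codimension. *)
Lemma saturated_codim2_ideal :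
  exists (l : H 1) (q : H 2), [/\ val l != 0, ~ divides (val l) (val q)
    & forall p, I p <-> ideal2 (val l) (val q) p].
Proof.
have [d0 dn] := codim_values.
have d1 := dn 1%N isT; have d2 := dn 2%N isT.
have f0 := dim_forms k 0; have f1 := dim_forms k 1; have f2 := dim_forms k 2.
pose l := vpick (U 1).
have nl : l != 0 by rewrite vpick0 -dimv_eq0; lia.
have nvl : val l != 0 by apply: contra nl => /eqP e; apply/eqP/val_inj.
have [q qU nq] : exists2 q, q \in U 2 & q \notin imgh (erefl : 1 + 1 = 2)%N l.
  apply/subvPn; apply/negP => /dimvS; rewrite dim_imgh //; lia.
have ndq : ~ divides (val l) (val q) by move/imghP => h; rewrite h in nq.
have Il : I (val l) by apply/U_mem/memv_pick.
have Iq : I (val q) by apply/U_mem.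
have sub p : ideal2 (val l) (val q) p -> I p.
  by move=> [a [b ->]]; apply: ID; rewrite mulrC; apply: IM.
exists l, q; split=> // p; split=> [Ip|]; last exact: sub.
have J0 : ideal2 (val l) (val q) 0 by exists 0, 0; rewrite !mulr0 addr0.
have JD u v : ideal2 (val l) (val q) u -> ideal2 (val l) (val q) v ->
    ideal2 (val l) (val q) (u + v).
  by move=> [a [b ->]] [a' [b' ->]]; exists (a + a'), (b + b'); ring.
have JZ c u : ideal2 (val l) (val q) u -> ideal2 (val l) (val q) (c *: u).
  move=> [a [b ->]]; exists (c *: a), (c *: b).
  by rewrite scalerDr !scalerAr.
rewrite (@pihomog_partitionE _ _ mdeg (msize p) p) //.
apply: (big_ind (ideal2 (val l) (val q))) => // i _.
have Ipi : I (pihomog mdeg i p) by have [_ h] := I_homog; apply: h.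
move: (nat_of_ord i) Ipi => n Ipn.
have pU : DHomog (pihomogP mdeg n p) \in U n by apply/U_mem.
case: n Ipn pU => [|[|n]] Ipn pU.
- have /eqP U0 : U 0 == 0%VS by rewrite -dimv_eq0; lia.
  by move: pU; rewrite U0 memv0 => /eqP /(congr1 val) /= ->.
- have e1 : <[l]>%VS = U 1.
    by apply/eqP; rewrite eqEdim -memvE memv_pick /= dim_vline nl; lia.
  move: pU; rewrite -e1 => /vlineP [c /(congr1 val) /= ->].
  by exists c%:MP, 0; rewrite mulr0 addr0 mulrC mul_mpolyC.
have [V hV] := subspace_forms n.+2 J0 JD JZ.
have dV := ideal2_space nvl ndq hV; have dU := dn n.+2 isT.
have eV : V = U n.+2.
  apply/eqP; rewrite eqEdim; apply/andP; split; last by lia.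
  by apply/subvP=> u /hV /sub /U_mem.
by move: pU; rewrite -eV => /hV.
Qed.

End Saturated.

(** * From the Bourbaki degree to the resolution *)

Section IsForm.
Variable k : fieldType.
Local Notation R := {mpoly k[3]}.

Lemma is_formE (z : int) n (p : R) : z = n%:Z -> is_form z p = (p \is n.-homog).
Proof. by move=> ->. Qed.

Lemma is_form_pihomog (z : int) n (p : R) : is_form z p ->
  pihomog mdeg n p != 0 -> z = n%:Z.
Proof.
case: z => [a|a] /= hp.
  have [-> //|na] := eqVneq a n.
  by rewrite (pihomog_ne0 na hp) eqxx.
by rewrite (eqP hp) pihomog0 eqxx.
Qed.

Lemma mderiv_homog d (p : R) i : p \is d.+1.-homog -> p^`M(i) \is d.-homog.
Proof.
move=> hp; apply/dhomogP => m; rewrite mcoeff_msupp mcoeff_deriv => nz.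
have : p@_(m + U_(i)) != 0 by apply: contra nz => /eqP ->; rewrite mul0rn.
rewrite -mcoeff_msupp => /(dhomog_mf hp) h.
by have : mdeg (m + U_(i)) = d.+1 by []; rewrite mdegD mdeg1 addn1 => -[].
Qed.
End IsForm.

(** With n = m+d+e, the numbers [D1], [D2], [D3], [D4] are the dimensions of R_(n+e-d), R_n,
    R_(n+d), R_(n-e), and D1 - (3 D2 - D3 - D4) equals d^2 + e^2 - de. The terms are moved so that
    no truncated subtraction occurs. *)
Lemma codim_bound_arith d e m D1 D2 D3 D4 K ker img u :
  (img <= u -> ker <= D4 -> 3 * D2 <= K + D3 -> ker + img = K ->
  2 * D1 = (m + (e + e)).+1 * (m + (e + e)).+2 ->
  2 * D2 = (m + d + e).+1 * (m + d + e).+2 ->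
  2 * D3 = (d + (m + d + e)).+1 * (d + (m + d + e)).+2 ->
  2 * D4 = (m + d).+1 * (m + d).+2 ->
  D1 + d * e <= u + (d * d + e * e))%N.
Proof. lia. Qed.

Section Syz.
Variables (k : fieldType) (f : {mpoly k[3]}) (d : nat).
Local Notation R := {mpoly k[3]}.
Local Notation H := (dhomog 3 k).
Hypothesis f_homog : f \is d.+1.-homog.

Let fi i : H d := DHomog (mderiv_homog i f_homog).

Lemma syz_part_subproof n (v : Syz f) :
  (\row_i pihomog mdeg n (syz_val v 0 i)) \in syz_pred f.
Proof.
apply/eqP; have := congr1 (pihomog mdeg (d + n)) (syz_rel v).
rewrite raddf_sum pihomog0 => e; rewrite -[RHS]e; apply: eq_bigr => i _.
by rewrite mxE mulrC -(pihomogM n _ (valP (fi i))) mulrC.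
Qed.

Definition syz_part n v : Syz f := MkSyz (syz_part_subproof n v).

Lemma syz_part_homog n v : syz_homog n (syz_part n v).
Proof. by move=> i; rewrite /= mxE; apply: pihomogP. Qed.

Lemma syz_part_sum v : exists M, v = \sum_(n < M) syz_part n v.
Proof.
pose M := (\max_i msize (syz_val v 0%R i))%N; exists M; apply: syz_eqP => i.
rewrite (big_morph (fun w : Syz f => syz_val w 0 i) (fun a b => syz_valD a b i) (syz_val0 f i)).
rewrite [LHS](@pihomog_partitionE _ _ mdeg M) ?leq_bigmax //.
by apply: eq_bigr => n _; rewrite /= mxE.
Qed.

Section Graded.
Variables (e : nat) (phi : {linear Syz f -> R^o}).
Hypothesis phi_graded :
  forall n v, syz_homog n v -> is_form (n%:Z + (e%:Z - d%:Z)) (phi v).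

(** As [phi] is graded, only one homogeneous component of a lift contributes in degree n. Since p is
    nonzero such a component exists, so its degree n + d - e is a natural number. *)
Lemma lift_form n p : p \is n.-homog -> p != 0 -> (exists v, phi v = p) ->
  exists m v, [/\ syz_homog m v, phi v = p & (m + e = n + d)%N].
Proof.
move=> hp np [v ev]; have [M eM] := syz_part_sum v.
have ep : p = \sum_(m < M) pihomog mdeg n (phi (syz_part m v)).
  by rewrite -[LHS](pihomog_dE hp) -ev [in LHS]eM !raddf_sum.
have [m nm] : exists m : 'I_M, pihomog mdeg n (phi (syz_part m v)) != 0.
  apply/existsP; apply: contraNT np; rewrite negb_exists => /forallP h.
  by rewrite ep big1 // => i _; apply/eqP; have := h i; rewrite negbK.
have zE (i : 'I_M) : pihomog mdeg n (phi (syz_part i v)) != 0 -> (i + e = n + d)%N.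
  by move/(is_form_pihomog (phi_graded (syz_part_homog i v))); lia.
have em := zE m nm; exists m, (syz_part m v); split=> //; first exact: syz_part_homog.
have /pihomog_dE <- : phi (syz_part m v) \is n.-homog.
  by rewrite -(is_formE (z := m%:Z + (e%:Z - d%:Z))); [apply/phi_graded/syz_part_homog | lia].
rewrite ep (bigD1 m) //= big1 ?addr0 // => i ni; apply/eqP; apply: contraNT ni => /zE ei.
by apply/eqP/val_inj => /=; lia.
Qed.

Variable eps : Syz f.
Hypothesis eps_homog : syz_homog e eps.
Hypothesis ker_phi : forall v, phi v = 0 <-> exists a : R, v = a *: eps.

(* Rank-nullity: dim Syz_n >= 3 dim R_n - dim R_(n+d), and phi has kernel R eps;
   the quadratic and linear terms cancel. *)
Lemma image_codim_bound m (U : {vspace H (m + (e + e))}) :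
  (forall p, (exists v, phi v = val p) -> p \in U) ->
  (\dim {: H (m + (e + e))} + d * e <= \dim U + (d * d + e * e))%N.
Proof.
(* With this [n] both n - e = m + d and n + e - d = m + 2e are natural numbers. *)
move=> hU; pose n := (m + d + e)%N.
pose V := {ffun 'I_3 -> H n}.
pose Psi (v : V) : H (d + n) := \sum_i mulh erefl (fi i) (v i).
have Psi_lin : linear Psi.
  move=> a u v; rewrite /Psi scaler_sumr -big_split; apply: eq_bigr => i _.
  by rewrite !ffunE linearP.
pose Psi_m := GRing.isLinear.Build _ _ _ _ Psi Psi_lin.
pose PsiL : {linear V -> H (d + n)} := HB.pack Psi Psi_m.
pose K := lker (linfun PsiL).
have K_syz (v : subvs_of K) : (\row_i val (vsval v i)) \in syz_pred f.
  have := subvsP v; rewrite memv_ker lfunE => /eqP /(congr1 val) /= h.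
  apply/eqP; rewrite -[RHS]h /Psi raddf_sum; apply: eq_bigr => i _.
  by rewrite mxE /= mulrC.
pose S v : Syz f := MkSyz (K_syz v).
have S_homog v : syz_homog n (S v) by move=> i; rewrite /= mxE; apply: valP.
have S_phi v : phi (S v) \is (m + (e + e)).-homog.
  by rewrite -(is_formE (z := n%:Z + (e%:Z - d%:Z))); [exact: phi_graded | rewrite /n; lia].
pose Phi (v : subvs_of K) : H (m + (e + e)) := DHomog (S_phi v).
have Phi_lin : linear Phi.
  move=> a u v; apply: val_inj => /=.
  have -> : S (a *: u + v) = a%:MP *: S u + S v.
    by apply: syz_eqP => i; rewrite !syz_valE /= !mxE !ffunE /= mul_mpolyC.
  by rewrite linearD phiZ mul_mpolyC.
pose Phi_m := GRing.isLinear.Build _ _ _ _ Phi Phi_lin.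
pose PhiL : {linear subvs_of K -> H (m + (e + e))} := HB.pack Phi Phi_m.
have dimPhi : (\dim (limg (linfun PhiL)) <= \dim U)%N.
  apply/dimvS/subvP=> p /memv_imgP [v _ ->]; rewrite lfunE; apply: hU.
  by exists (S v).
pose E (b : H (m + d)) : V := [ffun i => mulh (addnC e (m + d)) (DHomog (eps_homog i)) b].
have E_lin : linear E.
  by move=> a u v; apply/ffunP=> i; rewrite !ffunE linearP.
pose E_m := GRing.isLinear.Build _ _ _ _ E E_lin.
pose EL : {linear H (m + d) -> V} := HB.pack E E_m.
have dimker : (\dim (lker (linfun PhiL)) <= \dim {: H (m + d)})%N.
  pose vs : {linear subvs_of K -> V} := vsval.
  have <- : \dim (linfun vs @: lker (linfun PhiL)) = \dim (lker (linfun PhiL)).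
    apply: limg_dim_eq; apply/eqP; rewrite -subv0; apply/subvP=> v /memv_capP [_].
    rewrite memv_ker lfunE memv0 => /eqP v0; apply/eqP.
    by apply: (@subvs_inj _ _ K); rewrite [RHS]linear0; exact: v0.
  apply: leq_trans (_ : \dim (limg (linfun EL)) <= _)%N; last first.
    by rewrite -(limg_ker_dim (linfun EL) fullv) leq_addl.
  apply/dimvS/subvP=> u /memv_imgP [v]; rewrite memv_ker lfunE => /eqP /(congr1 val) /= hv ->.
  have [a ea] : exists a : R, S v = a *: eps by apply/ker_phi.
  rewrite lfunE /=.
  have -> : vsval v = linfun EL (DHomog (pihomogP mdeg (m + d) a)).
    rewrite lfunE; apply/ffunP=> i; rewrite ffunE; apply: val_inj => /=.
    have hi : a * syz_val eps 0 i = val (vsval v i).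
      by rewrite -syz_valZ -ea /= mxE.
    rewrite -(pihomogM _ _ (eps_homog i)) mulrC hi addnC pihomog_dE //.
    exact: valP.
  exact/memv_img/memvf.
have dimK : (3 * \dim {: H n} <= \dim K + \dim {: H (d + n)})%N.
  have := limg_ker_dim (linfun PsiL) fullv; rewrite capfv -/K => dk.
  have dV : \dim {: V} = (3 * \dim {: H n})%N by rewrite dimvf /dim /= card_ord dimvf.
  rewrite -dV -dk leq_add2l; exact/dimvS/subvf.
have rkPhi : (\dim (lker (linfun PhiL)) + \dim (limg (linfun PhiL)) = \dim K)%N.
  by have := limg_ker_dim (linfun PhiL) fullv; rewrite capfv dimvf.
exact: (codim_bound_arith dimPhi dimker dimK rkPhi (dim_forms k (m + (e + e)))
  (dim_forms k n) (dim_forms k (d + n)) (dim_forms k (m + d))).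
Qed.
End Graded.
End Syz.

(** The product of the P - b over b <= B vanishes at all large integers, so it is zero, and so is
    one of its factors. *)
Lemma poly_bounded_const (P : {poly rat}) (N B : nat) (H : nat -> nat) :
  (forall n, (N <= n)%N -> (H n)%:R = P.[n%:R] /\ (H n <= B)%N) ->
  exists c, P = c%:P.
Proof.
move=> hP; pose Q := \prod_(b < B.+1) (P - (b%:R : rat)%:P).
have : Q = 0.
  pose rs := [seq (N + i)%N%:R : rat | i <- iota 0 (size Q)].
  apply: (@roots_geq_poly_eq0 _ Q rs); last by rewrite size_map size_iota.
    apply/allP => x /mapP [i _ ->]; have [h1 h2] := hP (N + i)%N (leq_addr _ _).
    rewrite /root horner_prod (bigD1 (Ordinal (h2 : (H (N + i) < B.+1)%N))) //=.
    by rewrite hornerD hornerN hornerC -h1 subrr mul0r.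
  rewrite map_inj_uniq ?iota_uniq // => i j /eqP.
  by rewrite Num.Theory.eqr_nat eqn_add2l => /eqP.
move/eqP/prodf_eq0 => [b _ /eqP/subr0_eq ->].
by eexists; reflexivity.
Qed.

Section Multiplicity.
Variable k : fieldType.
Local Notation R := {mpoly k[3]}.
Local Notation H := (dhomog 3 k).

(** The bound makes the Hilbert polynomial a constant. Were it zero, I would contain all forms of
    large degree and, by saturation, 1; so the multiplicity is that constant and not a length. *)
Lemma multiplicity_bounded (I : R -> Prop) b B N : multiplicity I b ->
  ~ I 1 -> (forall s, (forall i, I ('X_i * s)) -> I s) ->
  (forall m (U : {vspace H (m + N)}), (forall p, p \in U <-> I (val p)) ->
    (\dim {: H (m + N)} <= \dim U + B)%N) ->
  exists (M : nat) (U : forall n, {vspace H n}),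
    (forall n p, p \in U n <-> I (val p)) /\
    forall n, (M <= n)%N -> (\dim {: H n} = \dim (U n) + b)%N.
Proof.
move=> [h [P [N0 [hI hP hb]]]] nI1 I_sat bound.
have /all_sig2 [U hU hh] : forall n, {U : {vspace H n} | forall p, p \in U <-> I (val p) &
    h n = (\dim {: H n} - \dim U)%N}.
  move=> n.
  have : exists U : {vspace H n}, (forall p, p \in U <-> I (val p)) /\
     h n = (\dim {: H n} - \dim U)%N by have [U h1 h2] := hI n; exists U.
  by case/constructive_indefinite_description=> V [hV1 hV2]; exists V.
have le n : (\dim (U n) <= \dim {: H n})%N by apply/dimvS/subvf.
have [|c Pc] := @poly_bounded_const P (maxn N N0) B h.
  move=> n; rewrite geq_max => /andP [h1 h2]; split; first exact: hP.
  by rewrite hh leq_subLR; have := bound (n - N)%N _ (hU _); rewrite subnK.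
exists N0, U; split=> // n hn.
suff : h n = b by have := le n; rewrite hh; lia.
move: hb; case: eqP => [P0 _|/eqP nP hb].
  case: nI1.
  have full j p : p \is j.-homog -> (N0 <= j)%N -> I p.
    move=> hp hj; have := hP j hj; rewrite P0 horner0 => /eqP.
    rewrite Num.Theory.pnatr_eq0 hh => dj.
    have e : U j = fullv by apply/eqP; rewrite eqEdim subvf -subn_eq0.
    by apply: (hU j (DHomog hp)).1; rewrite e memvf.
  have down i : forall j p, p \is j.-homog -> (N0 <= i + j)%N -> I p.
    elim: i => [|i IH] j p hp hj; first exact: full hp hj.
    apply: I_sat => a; apply: (IH j.+1); last by rewrite -addSnnS.
    exact: (dhomogM (homogX k a) hp).
  by apply: (down N0 0%N); rewrite ?addn0 //; apply: dhomog1.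
apply/eqP; rewrite -(Num.Theory.eqr_nat rat) hP // hb Pc hornerC lead_coefC size_polyC.
by rewrite (_ : c != 0) ?fact0 ?mulr1 //; apply: contra nP => /eqP c0; rewrite Pc c0.
Qed.

End Multiplicity.

(** * Generators and relation of Syz from the Bourbaki ideal *)

Section Forward.
Variables (k : fieldType) (f : {mpoly k[3]}) (d : nat).
Local Notation R := {mpoly k[3]}.
Hypothesis f_homog : f \is d.+1.-homog.
Variables (e : nat) (eps : Syz f) (I : R -> Prop).
Hypothesis e_indeg : indeg_syz f e.
Hypothesis eps_homog : syz_homog e eps.
Hypothesis eps_neq0 : eps != 0.

Lemma bourbaki_ideal_deg2 : bourbaki_ideal d e eps I -> multiplicity I 2 ->
  exists (l q : R), [/\ l \is 1.-homog, q \is 2.-homog, l != 0, ~ divides l q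
    & forall p, I p <-> ideal2 l q p].
Proof.
move=> [[_ nI1] homI _ [phi [grad ker im]]] mult.
have I_sat s : (forall i, I ('X_i * s)) -> I s.
  move=> h; apply/im; apply: (image_saturated eps_neq0 ker) => i.
  exact/im.
have [M [U [hU codimU]]] : exists (M : nat) (U : forall n, {vspace dhomog 3 k n}),
    (forall n p, p \in U n <-> I (val p)) /\
    forall n, (M <= n)%N -> (\dim {: dhomog 3 k n} = \dim (U n) + 2)%N.
  apply: (@multiplicity_bounded _ I 2 (d * d + e * e) (e + e)) => // m U hU.
  apply: leq_trans (leq_addr (d * e) _) _.
  apply: (image_codim_bound f_homog grad eps_homog ker) => p hp.
  exact/hU/im.
have [l [q [nl ndq hI]]] := saturated_codim2_ideal homI nI1 I_sat hU codimU.
exists (val l), (val q); split=> //; exact: valP.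
Qed.

Lemma deg2_resolution : bourbaki_ideal d e eps I -> multiplicity I 2 -> (1 <= d)%N ->
  (2 * e <= d + 1)%N /\
   graded_min_free_res (gradient_ideal f)
     [tuple d%:Z + (d%:Z - e%:Z + 3)]
     [tuple d%:Z + (d%:Z - e%:Z + 2); d%:Z + (d%:Z - e%:Z + 1); d%:Z + e%:Z]
     [tuple d%:Z; d%:Z; d%:Z].
Proof.
move=> bI mI d1; have [l [q [hl hq nl ndq Ilq]]] := bourbaki_ideal_deg2 bI mI.
have [[_ nI1] homI _ [phi [grad ker im]]] := bI.
have nq : q != 0 by apply/eqP => q0; apply: ndq; exists 0; rewrite q0 mulr0.
have phi_eps : phi eps = 0 by apply/ker; exists 1; rewrite scale1r.
have phiM (a : R) v : phi (a *: v) = a * phi v by rewrite linearZ.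
have [mL [L [hL eL dL]]] : exists m v, [/\ syz_homog m v, phi v = l & (m + e = 1 + d)%N].
  apply: (lift_form f_homog grad) => //; apply/im/Ilq.
  by exists 1, 0; rewrite mulr1 mulr0 addr0.
have [mQ [Q [hQ eQ dQ]]] : exists m v, [/\ syz_homog m v, phi v = q & (m + e = 2 + d)%N].
  apply: (lift_form f_homog grad) => //; apply/im/Ilq.
  by exists 0, 1; rewrite mulr1 mulr0 add0r.
(* [L] is a nonzero syzygy of degree d + 1 - e, so minimality of e yields 2e <= d + 1. *)
have e_le : (e <= mL)%N.
  apply: (e_indeg.2 mL L hL); apply: contra nl => /eqP L0.
  by rewrite -eL L0 linear0.
split; first by lia.
have [c0 ec0] : exists c : R, q *: L - l *: Q = c *: eps.
  by apply/ker; rewrite linearB !phiM eL eQ mulrC subrr.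
(* The left side and eps are homogeneous, so this component of [c0] already gives the relation. *)
pose c := pihomog mdeg (mL + 2 - e) c0.
have hc : c \is (mL + 2 - e).-homog by exact: pihomogP.
have ec : q *: L - l *: Q = c *: eps.
  apply: syz_eqP => i; rewrite [RHS]syz_valZ mulrC -(pihomogM _ _ (eps_homog i)).
  have -> : syz_val eps 0 i * c0 = syz_val (q *: L - l *: Q) 0 i.
    by rewrite ec0 syz_valZ mulrC.
  rewrite pihomog_dE // (syz_val_combB q l L Q i).
  apply: rpredB.
    have -> : (e + (mL + 2 - e) = 2 + mL)%N by lia.
    exact: dhomogM.
  have -> : (e + (mL + 2 - e) = 1 + mQ)%N by lia.
  exact: dhomogM.
have e_pos : (0 < e)%N.
  rewrite lt0n; apply/eqP => e0.
  have [j nj] := syz_neq0 eps_neq0.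
  have ej : syz_val eps 0 j = ((syz_val eps 0 j)@_0%MM)%:MP.
    by apply: homog0_const; move: eps_homog; rewrite e0; apply.
  set u := (syz_val eps 0 j)@_0%MM in ej.
  have nu : u != 0 by apply: contra nj => /eqP u0; rewrite ej u0 mpolyC0.
  have inv : (u^-1)%:MP * syz_val eps 0 j = 1 by rewrite ej -mpolyCM mulVf // mpolyC1.
  (* Coordinate j of eps is a unit, so a multiple of eps clears that coordinate without changing
     [phi]. The relation between the reduced lifts then has no eps term, and primality of l lets l
     divide the reduced [L]. *)
  have [red [redj phi_red]] : exists red : Syz f -> Syz f,
      (forall v, syz_val (red v) 0 j = 0) /\ (forall v, phi (red v) = phi v).
    exists (fun v => v - ((u^-1)%:MP * syz_val v 0 j) *: eps); split=> v.
      rewrite (syz_valD v) (syz_valN (_ *: eps)) (syz_valZ _ eps).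
      by rewrite mulrAC inv mul1r subrr.
    by rewrite linearB phiM phi_eps mulr0 subr0.
  have [c1 ec1] : exists c : R, q *: red L - l *: red Q = c *: eps.
    by apply/ker; rewrite linearB !phiM !phi_red eL eQ mulrC subrr.
  have c10 : c1 = 0.
    apply/eqP; move: (congr1 (fun w : Syz f => syz_val w 0 j) ec1).
    rewrite (syz_val_combB q l (red L) (red Q) j) (syz_valZ c1 eps) (redj L) (redj Q) !mulr0 subr0.
    by move=> /esym /eqP; rewrite mulf_eq0 (negbTE nj) orbF.
  have eqr i : q * syz_val (red L) 0 i = l * syz_val (red Q) 0 i.
    apply/eqP; rewrite -subr_eq0; apply/eqP.
    have := congr1 (fun w : Syz f => syz_val w 0 i) ec1.
    by rewrite (syz_val_combB q l (red L) (red Q) i) c10 scale0r (syz_val0 f i).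
  have /all_sig [t ht] : forall i, {t | syz_val (red L) 0 i = l * t}.
    move=> i; apply: constructive_indefinite_description.
    have : divides l (q * syz_val (red L) 0 i) by exists (syz_val (red Q) 0 i).
    by case/(linear_form_prime hl nl).
  have [T eT] := syz_divide nl ht.
  apply: nI1; apply/im; exists T; apply: (mulfI nl).
  by rewrite -phiM -eT phi_red eL mulr1.
pose B3 : 'M[R]_(1, 3) := \row_j nth 0 [:: l; - q; c] j.
pose S i : Syz f := nth 0 [:: Q; L; eps] i.
pose B2 : 'M[R]_(3, 3) := \matrix_(i, j) syz_val (S i) 0 j.
pose B1 : 'M[R]_(3, 1) := \matrix_(i, j) f^`M(i).
have mulB2 (u : 'rV[R]_3) j :
    (u *m B2) 0 j = syz_val (u 0 0 *: Q + u 0 1 *: L + u 0 2%:R *: eps) 0 j.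
  by rewrite syz_val_comb3 mxE sum_ord3 !mxE.
have mulB2_eq0 (u : 'rV[R]_3) : u *m B2 = 0 <-> u 0 0 *: Q + u 0 1 *: L + u 0 2%:R *: eps = 0.
  split=> h; first by apply: syz_eqP => j; rewrite -mulB2 h !mxE.
  by apply/rowP=> j; rewrite mulB2 h !mxE.
have rel : l *: Q - q *: L + c *: eps = 0.
  by rewrite -ec -(opprB (l *: Q)) subrr.
exists B3, B2, B1; split.
- split.
  + move=> i; elim/ord3_ind; rewrite ord1 mxE !(tnth_nth 0) /=.
    * by rewrite (is_formE (n := 1)); [|lia].
    * by rewrite (is_formE (n := 2)); [rewrite rpredN|lia].
    * by rewrite (is_formE (n := mL + 2 - e)); [|lia].
  + elim/ord3_ind; elim/ord3_ind; rewrite mxE !(tnth_nth 0) /S /=.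
    1-3: by rewrite (is_formE (n := mQ)); [exact: hQ|lia].
    1-3: by rewrite (is_formE (n := mL)); [exact: hL|lia].
    1-3: by rewrite (is_formE (n := e)); [exact: eps_homog|lia].
  + move=> i j; rewrite ord1 mxE (is_formE (n := d)); first exact: mderiv_homog.
    by elim/ord3_ind: i; rewrite !(tnth_nth 0) /=; lia.
- split.
  + move=> i; elim/ord3_ind; rewrite ord1 mxE /=.
    * exact: homog_coef0 hl.
    * by apply: (homog_coef0 (n := 2)) => //; rewrite rpredN.
    * by apply: homog_coef0 hc; lia.
  + elim/ord3_ind=> j; rewrite mxE /S /=.
    * by apply: homog_coef0 (hQ j); lia.
    * by apply: homog_coef0 (hL j); lia.
    * by apply: homog_coef0 (eps_homog j).
  + by move=> i j; rewrite mxE; apply: homog_coef0 (mderiv_homog i f_homog).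
- split.
  + move=> u /(congr1 (fun v : 'rV_3 => v 0 0)); rewrite !mxE big_ord_recl big_ord0 addr0 mxE /=.
    move/eqP; rewrite mulf_eq0 (negbTE nl) orbF => /eqP u0.
    by apply/rowP=> i; rewrite ord1 mxE.
  + move=> u; rewrite mulB2_eq0; split=> [h|[v ->]].
      have h1 : u 0 0 * q + u 0 1 * l = 0.
        have := congr1 phi h; rewrite linear0 !linearD !phiM phi_eps eL eQ.
        by rewrite mulr0 addr0.
      have : divides l (u 0 0 * q).
        by exists (- u 0 1); apply/eqP; rewrite mulrN -addr_eq0 (mulrC l) h1.
      case/(linear_form_prime hl nl) => // -[t et].
      have e1 : u 0 1 = t * - q.
        apply: (mulfI nl); apply/eqP; rewrite -subr_eq0 -h1 et; apply/eqP; ring.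
      exists (t%:M); apply/rowP=> j; rewrite mul_scalar_mx mxE.
      have e2 : u 0 2%:R = t * c.
        apply/eqP; rewrite -subr_eq0; apply/eqP; apply: (syz_scaler_inj eps_neq0).
        rewrite scalerBl -scalerA.
        have -> : c *: eps = - (l *: Q - q *: L) by apply/eqP; rewrite -addr_eq0 addrC rel.
        by rewrite -h et e1 scalerN opprK scalerBr !scalerA addrC mulrN scaleNr (mulrC l).
      by elim/ord3_ind: j; rewrite mxE /= ?e1 ?e2 // et mulrC.
    rewrite !mxE !big_ord_recl !big_ord0 !addr0 !mxE /=.
    by rewrite -!scalerA -!scalerDr scaleNr rel scaler0.
  + move=> u; split=> [h|[v ->]].
      have hu : u \in syz_pred f.
        apply/eqP; have := congr1 (fun v : 'M_1 => v 0 0) h; rewrite !mxE => e0.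
        by rewrite -[RHS]e0; apply: eq_bigr => i _; rewrite mxE.
      pose w := MkSyz hu.
      have /Ilq [a [b eab]] : I (phi w) by apply/im; exists w.
      have /ker [g eg] : phi (w - a *: L - b *: Q) = 0.
        by rewrite !linearB !phiM eab eL eQ; ring.
      pose U : 'rV[R]_3 := \row_j nth 0 [:: b; a; g] j.
      have [U0 U1 U2] : [/\ U 0 0 = b, U 0 1 = a & U 0 2%:R = g] by split; rewrite mxE.
      exists U; apply/rowP=> j; rewrite mulB2 U0 U1 U2 -eg.
      by rewrite addrC addrA !subrK.
    rewrite -mulmxA; suff -> : B2 *m B1 = 0 by rewrite mulmx0.
    apply/matrixP=> i j; rewrite !mxE; apply: etrans (syz_rel (S i)).
    by apply: eq_bigr => a _; rewrite !mxE.
  + move=> p; split=> [[a ->]|[v ->]].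
      by exists (\row_i a i); rewrite mxE; apply: eq_bigr => i _; rewrite !mxE.
    by exists (fun i => v 0 i); rewrite mxE; apply: eq_bigr => i _; rewrite !mxE.
Qed.

End Forward.

(** * From the resolution to the Bourbaki degree *)

Section Coef0.
Variable k : fieldType.
Local Notation R := {mpoly k[3]}.

Lemma mcoeff0M (p q : R) : (p * q)@_0%MM = p@_0%MM * q@_0%MM.
Proof. exact: rmorphM (mcoeff 0%MM) p q. Qed.

Lemma pihomog_mul n m (h t : R) : h \is m.-homog ->
  pihomog mdeg n (h * t) = h * (if (m <= n)%N then pihomog mdeg (n - m) t else 0).
Proof.
move=> hh; case: leqP => [le|lt]; last by rewrite mulr0 (pihomogM_small _ hh lt).
by rewrite -{1}(subnKC le) pihomogM.
Qed.

Lemma coef0_pihomog (p : R) : (pihomog mdeg 0 p)@_0%MM = p@_0%MM.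
Proof.
have := @pihomog_partitionE _ _ mdeg (msize p).+1 p (leqnSn _).
rewrite big_ord_recl => /(congr1 (mcoeff 0%MM)); rewrite mcoeffD => ->.
rewrite [X in _ = _ + X](_ : _ = 0) ?addr0 //; rewrite raddf_sum; apply: big1 => j _.
by apply: (homog_coef0 (n := bump 0 j)) => //; apply: pihomogP.
Qed.

(** In degree d only the constant terms of the [a i] contribute. *)
Lemma constant_coefficients d n (h : 'I_n -> R) (p : R) (a : 'I_n -> R) :
  (forall i, h i \is d.-homog) -> p \is d.-homog -> p = \sum_i a i * h i ->
  p = \sum_i ((a i)@_0%MM)%:MP * h i.
Proof.
move=> hh hp ep; rewrite -(pihomog_dE hp) {1}ep raddf_sum; apply: eq_bigr => i _ /=.
rewrite mulrC (pihomog_mul _ _ (hh i)) leqnn subnn (homog0_const (pihomogP _ _ _)) mulrC.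
by rewrite coef0_pihomog.
Qed.

Lemma ideal2_homogeneous (l q : R) : l \is 1.-homog -> q \is 2.-homog ->
  homogeneous_ideal (ideal2 l q).
Proof.
move=> hl hq; split; first split.
- by exists 0, 0; rewrite !mulr0 addr0.
- by move=> u v [a [b ->]] [a' [b' ->]]; exists (a + a'), (b + b'); ring.
- by move=> c u [a [b ->]]; exists (c * a), (c * b); ring.
move=> p n [a [b ->]]; rewrite raddfD /= (pihomog_mul _ _ hl) (pihomog_mul _ _ hq).
by eexists; eexists; reflexivity.
Qed.

Lemma ideal2_proper (l q : R) : l \is 1.-homog -> q \is 2.-homog -> ~ ideal2 l q 1.
Proof.
move=> hl hq [a [b /(congr1 (mcoeff 0%MM))]]; rewrite mcoeffD !mcoeff0M.
rewrite (homog_coef0 _ hl) // (homog_coef0 _ hq) // !mul0r addr0 mcoeff1 eqxx.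
by move/eqP; rewrite oner_eq0.
Qed.

Lemma ideal2_multiplicity (l q : R) : l \is 1.-homog -> q \is 2.-homog -> l != 0 ->
  ~ divides l q -> multiplicity (ideal2 l q) 2.
Proof.
move=> hl hq nl ndq; have [[J0 JD JM] _] := ideal2_homogeneous hl hq.
have JZ (c : k) p : ideal2 l q p -> ideal2 l q (c *: p).
  by rewrite -mul_mpolyC; apply: JM.
have /all_sig [U hU] : forall n, {U : {vspace dhomog 3 k n} |
    forall p, p \in U <-> ideal2 l q (val p)}.
  by move=> n; apply: constructive_indefinite_description; apply: subspace_forms.
exists (fun n => \dim {: dhomog 3 k n} - \dim (U n))%N, 2%:P, 2%N; split.
- by move=> n; exists (U n).
- move=> [|[|n]] // _; rewrite hornerC.
  have := @ideal2_space _ (DHomog hl) (DHomog hq) n (U n.+2) nl ndq (hU n.+2).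
  by move=> <-; rewrite addKn.
by rewrite polyC_eq0 lead_coefC size_polyC fact0 mulr1.
Qed.
End Coef0.

(** * Syzygy modules with three generators and one relation *)

Section Presentation.
Variables (k : closedFieldType) (f : {mpoly k[3]}) (d e : nat).
Local Notation R := {mpoly k[3]}.
Variables (s : 'I_3 -> Syz f) (l q c : R).
Hypothesis f_homog : f \is d.+1.-homog.
Hypothesis e_indeg : indeg_syz f e.
Hypothesis e_le : (2 * e <= d + 1)%N.
Hypothesis s0_homog : syz_homog (d + 2 - e) (s 0).
Hypothesis s1_homog : syz_homog (d + 1 - e) (s 1).
Hypothesis s2_homog : syz_homog e (s 2%:R).
Hypothesis l_homog : l \is 1.-homog.
Hypothesis q_homog : q \is 2.-homog.
Hypothesis c_coef0 : c@_0%MM = 0.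
Hypothesis s_gen : forall v, exists a0 a1 a2 : R, v = a0 *: s 0 + a1 *: s 1 + a2 *: s 2%:R.
Hypothesis s_rel : forall a0 a1 a2 : R, a0 *: s 0 + a1 *: s 1 + a2 *: s 2%:R = 0 <->
  exists t, [/\ a0 = t * l, a1 = t * q & a2 = t * c].
Hypothesis rel_neq0 : forall t : R, t * l = 0 -> t * q = 0 -> t * c = 0 -> t = 0.

Let l0 : l@_0%MM = 0. Proof. exact: homog_coef0 l_homog. Qed.
Let q0 : q@_0%MM = 0. Proof. exact: homog_coef0 q_homog. Qed.

Lemma relation_coef0 (a0 a1 a2 : R) : a0 *: s 0 + a1 *: s 1 + a2 *: s 2%:R = 0 ->
  [/\ a0@_0%MM = 0, a1@_0%MM = 0 & a2@_0%MM = 0].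
Proof. by move=> /s_rel [t [-> -> ->]]; rewrite !mcoeff0M l0 q0 c_coef0 !mulr0. Qed.

Let relation : l *: s 0 + q *: s 1 + c *: s 2%:R = 0.
Proof. by apply/s_rel; exists 1; rewrite !mul1r. Qed.

Lemma s2_neq0 : s 2%:R != 0.
Proof.
apply/eqP => s20; have [] := @relation_coef0 0 0 1.
  by rewrite !scale0r scale1r s20 !addr0.
by move=> _ _ /eqP; rewrite mcoeff1 eqxx oner_eq0.
Qed.

(** The quotient of [s 2] by g would be a nonzero syzygy of degree e - n, below the initial degree;
    if n > e, the coordinates of [s 2] would vanish. *)
Lemma s2_primitive n (g : R) (t : 'I_3 -> R) : (0 < n)%N -> g \is n.-homog -> g != 0 ->
  (forall i, syz_val (s 2%:R) 0 i = g * t i) -> False.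
Proof.
move=> n0 hg ng hs; have [T eT] := syz_divide ng hs.
have nT : T != 0 by apply: contraNneq s2_neq0 => T0; rewrite eT T0 scaler0.
have gT i : g * syz_val T 0 i \is e.-homog by rewrite -syz_valZ -eT; apply: s2_homog.
have [le|lt] := leqP n e.
  have hT : syz_homog (e - n) T.
    by move=> i; apply: (homog_cofactor hg ng); rewrite subnKC.
  by have := e_indeg.2 _ _ hT nT; lia.
have [i ni] := syz_neq0 s2_neq0; case/eqP: ni.
by rewrite eT syz_valZ; apply: homog_cofactor_small hg lt (gT i).
Qed.

(* If l = 0 or q = l q', two generators become proportional, and the resulting
   relations make the coordinates of s 2 divisible by q or l. *)
Lemma l_neq0 : l != 0.
Proof.
apply/eqP => lz; have := relation; rewrite lz scale0r add0r => r.
have nq : q != 0.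
  apply/eqP => qz; have cz : c = 0.
    by apply: (syz_scaler_inj s2_neq0); rewrite -r qz scale0r add0r.
  have := @rel_neq0 1; rewrite lz qz cz !mulr0 => /(_ erefl erefl erefl) /eqP.
  by rewrite oner_eq0.
have /all_sig [t ht] : forall i, {t | syz_val (s 2%:R) 0 i = q * t}.
  move=> i; apply: constructive_indefinite_description.
  set x := syz_val (s 2%:R) 0 i; set y := syz_val (s 1) 0 i.
  have ry : q * y + c * x = 0.
    by rewrite /y /x -!syz_valZ -syz_valD r syz_val0.
  (* After multiplication by q the left side is -(qy + cx) times [s 2], which is zero. So this is a
     relation, and its middle coefficient x is a multiple of q. *)
  have : 0 *: s 0 + x *: s 1 + (- y) *: s 2%:R = 0.
    rewrite scale0r add0r; apply: (syz_scaler_inj0 nq).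
    rewrite scalerDr !scalerA (mulrC q x) -(scalerA x q).
    have -> : q *: s 1 = (- c) *: s 2%:R.
      by rewrite scaleNr; apply/eqP; rewrite -addr_eq0 r.
    rewrite scalerA -scalerDl.
    have -> : x * - c + q * - y = - (q * y + c * x) by ring.
    by rewrite ry oppr0 scale0r.
  by move=> /s_rel [t [_ -> _]]; exists t; rewrite mulrC.
exact: (@s2_primitive 2 q t).
Qed.

Lemma l_ndivides_q : ~ divides l q.
Proof.
case=> q' eq; pose T := s 0 + q' *: s 1.
have rT : l *: T + c *: s 2%:R = 0 by rewrite /T scalerDr scalerA -eq.
have /all_sig [t ht] : forall i, {t | syz_val (s 2%:R) 0 i = l * t}.
  move=> i; apply: constructive_indefinite_description.
  set x := syz_val (s 2%:R) 0 i; set y := syz_val T 0 i.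
  have ry : l * y + c * x = 0.
    by rewrite /y /x -!syz_valZ -syz_valD rT syz_val0.
  have : x *: s 0 + (x * q') *: s 1 + (- y) *: s 2%:R = 0.
    have -> : x *: s 0 + (x * q') *: s 1 = x *: T by rewrite /T scalerDr scalerA.
    apply: (syz_scaler_inj0 l_neq0); rewrite scalerDr !scalerA (mulrC l x) -(scalerA x l).
    have -> : l *: T = (- c) *: s 2%:R.
      by rewrite scaleNr; apply/eqP; rewrite -addr_eq0 rT.
    rewrite scalerA -scalerDl.
    have -> : x * - c + l * - y = - (l * y + c * x) by ring.
    by rewrite ry oppr0 scale0r.
  by move=> /s_rel [t [-> _ _]]; exists t; rewrite mulrC.
exact: (@s2_primitive 1 l t _ l_homog l_neq0).
Qed.

Lemma syz_sum3 (a : 'I_3 -> R) :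
  \sum_i a i *: s i = a 0 *: s 0 + a 1 *: s 1 + a 2%:R *: s 2%:R.
Proof. exact: sum_ord3. Qed.

Lemma relation_coef0_ord (a : 'I_3 -> R) : \sum_i a i *: s i = 0 ->
  forall i, (a i)@_0%MM = 0.
Proof. by rewrite syz_sum3 => /relation_coef0 [h0 h1 h2]; elim/ord3_ind. Qed.

(* A basis would have three elements, since X Y = 1 and Y X = 1 modulo (x, y, z)
   for the transition matrices; then Y is invertible and kills the relation. *)
Lemma syz_not_free : ~ free_divisor f.
Proof.
case=> n [phi [psi psiK phiK]].
have phi_sum (u : 'rV[R]_n) : phi u = \sum_i u 0 i *: phi (delta_mx 0 i).
  by rewrite {1}(row_sum_delta u) linear_sum; apply: eq_bigr => i _; rewrite linearZ.
have /all_sig [X hX] : forall i, {a : 'I_3 -> R | phi (delta_mx 0 i) = \sum_b a b *: s b}.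
  move=> i; apply: constructive_indefinite_description.
  have [a0 [a1 [a2 ->]]] := s_gen (phi (delta_mx 0 i)).
  by exists (fun b => nth 0 [:: a0; a1; a2] b); rewrite syz_sum3.
pose Xm : 'M[R]_(n, 3) := \matrix_(i, b) X i b.
pose Y : 'M[R]_(3, n) := \matrix_(a, i) psi (s a) 0 i.
have phiY a : phi (row a Y) = s a.
  by rewrite -[RHS]phiK; congr (phi _); apply/rowP => i; rewrite !mxE.
have phi_lin m (w : 'I_m -> R) (F : 'I_m -> 'rV[R]_n) :
    phi (\sum_i w i *: F i) = \sum_i w i *: phi (F i).
  by rewrite linear_sum; apply: eq_bigr => i _; rewrite linearZ.
have XY : Xm *m Y = 1%:M.
  apply/row_matrixP => i; apply: (can_inj psiK); rewrite row1 hX row_mul mulmx_sum_row.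
  by rewrite phi_lin; apply: eq_bigr => b _; rewrite phiY !mxE.
have YX a b : ((Y *m Xm) a b)@_0%MM = (a == b)%:R.
  have : \sum_b ((Y *m Xm) a b - (a == b)%:R) *: s b = 0.
    under eq_bigr do rewrite scalerBl.
    rewrite sumrB [X in _ - X](bigD1 a) //= eqxx scale1r [X in _ - (_ + X)]big1 ?addr0; last first.
      by move=> b' /negbTE nb; rewrite eq_sym nb scale0r.
    apply/eqP; rewrite subr_eq0 -[X in _ == X]phiY phi_sum; apply/eqP.
    under [RHS]eq_bigr do rewrite hX scaler_sumr mxE.
    rewrite exchange_big; apply: eq_bigr => b' _; rewrite mxE scaler_suml.
    by apply: eq_bigr => i _; rewrite !mxE scalerA.
  by move/relation_coef0_ord => /(_ b); rewrite mcoeffB => /eqP;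
     rewrite subr_eq0 => /eqP ->; case: (a == b); rewrite ?mcoeff1 ?eqxx ?mcoeff0.
pose ev m p (A : 'M[R]_(m, p)) : 'M[k]_(m, p) := map_mx (mcoeff 0%MM) A.
have n3 : n = 3%N.
  apply/eqP; rewrite eqn_leq; apply/andP; split.
    apply: (@mulmx1_min k _ _ (ev _ _ Xm) (ev _ _ Y)).
    by rewrite /ev -map_mxM XY map_mx1.
  apply: (@mulmx1_min k _ _ (ev _ _ Y) (ev _ _ Xm)).
  by rewrite /ev -map_mxM; apply/matrixP => a b; rewrite [LHS]mxE [RHS]mxE; exact: YX.
clear YX ev; subst n.
pose r : 'rV[R]_3 := \row_b nth 0 [:: l; q; c] b.
have rY : r *m Y = 0.
  apply: (can_inj psiK); rewrite linear0 mulmx_sum_row phi_lin.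
  under eq_bigr do rewrite phiY.
  by rewrite syz_sum3 !mxE.
have : r = 0 by rewrite -[r]mulmx1 -(mulmx1C XY) mulmxA rY mul0mx.
by move/(congr1 (fun u : 'rV_3 => u 0 0)); rewrite !mxE; apply/eqP/l_neq0.
Qed.

(** Well defined because (q, -l, 0) pairs to zero with the relation (l, q, c), so the coefficients
    picked by choice do not matter. *)
Lemma presentation_map : exists phi : {linear Syz f -> R^o},
  forall a0 a1 a2 : R, phi (a0 *: s 0 + a1 *: s 1 + a2 *: s 2%:R) = a0 * q - a1 * l.
Proof.
have /all_sig [A hA] : forall v, {a : 'I_3 -> R |
    v = a 0 *: s 0 + a 1 *: s 1 + a 2%:R *: s 2%:R}.
  move=> v; apply: constructive_indefinite_description.
  have [a0 [a1 [a2 ev]]] := s_gen v.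
  by exists (fun b => nth 0 [:: a0; a1; a2] b).
pose phi v : R^o := A v 0 * q - A v 1 * l.
have phiE a0 a1 a2 : phi (a0 *: s 0 + a1 *: s 1 + a2 *: s 2%:R) = a0 * q - a1 * l.
  set v := _ + _; have ev := hA v.
  have : (A v 0 - a0) *: s 0 + (A v 1 - a1) *: s 1 + (A v 2%:R - a2) *: s 2%:R = 0.
    rewrite !scalerBl; apply/eqP.
    rewrite [A v 0 *: _ - _ + _]addrACA -opprD addrACA -opprD -ev.
    by rewrite -/v subrr.
  move=> /s_rel [t [/eqP]]; rewrite subr_eq => /eqP e0 /eqP; rewrite subr_eq => /eqP e1 _.
  by rewrite /phi e0 e1; ring.
have phi_lin : linear phi.
  move=> a u v; rewrite {1}(hA u) {1}(hA v).
  have -> : a *: (A u 0 *: s 0 + A u 1 *: s 1 + A u 2%:R *: s 2%:R) +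
     (A v 0 *: s 0 + A v 1 *: s 1 + A v 2%:R *: s 2%:R) =
     (a * A u 0 + A v 0) *: s 0 + (a * A u 1 + A v 1) *: s 1 +
     (a * A u 2%:R + A v 2%:R) *: s 2%:R.
    by rewrite !scalerDl -!scalerA !scalerDr addrACA (addrACA (a *: _)).
  rewrite phiE /phi -[a *: _]/(a * _); ring.
pose phi_m := GRing.isLinear.Build _ _ _ _ phi phi_lin.
by exists (HB.pack_for {linear Syz f -> R^o} phi phi_m).
Qed.

(** Taking degree n parts of the coordinates; the conditionals give a generator of degree above n
    the coefficient 0. *)
Lemma homogeneous_coefficients n (v : Syz f) : syz_homog n v ->
  exists a0 a1 a2 : R, v =
    (if (d + 2 - e <= n)%N then pihomog mdeg (n - (d + 2 - e)) a0 else 0) *: s 0 +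
    (if (d + 1 - e <= n)%N then pihomog mdeg (n - (d + 1 - e)) a1 else 0) *: s 1 +
    (if (e <= n)%N then pihomog mdeg (n - e) a2 else 0) *: s 2%:R.
Proof.
move=> hv; have [a0 [a1 [a2 ev]]] := s_gen v; exists a0, a1, a2; apply: syz_eqP => i.
rewrite syz_val_comb3 -(pihomog_dE (hv i)) {1}ev syz_val_comb3 !raddfD /=.
congr (_ + _ + _); rewrite mulrC [RHS]mulrC.
- exact: pihomog_mul (s0_homog i).
- exact: pihomog_mul (s1_homog i).
- exact: pihomog_mul (s2_homog i).
Qed.

Lemma presentation_bourbaki : bourbaki_ideal d e (s 2%:R) (ideal2 l q).
Proof.
have nl := l_neq0; have ndq := l_ndivides_q.
have [phi phiE] := presentation_map.
split.
- by split; [have [] := ideal2_homogeneous l_homog q_homog | exact: ideal2_proper].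
- exact: ideal2_homogeneous.
- exact: ideal2_codim.
exists phi; split.
- move=> n v /homogeneous_coefficients [a0 [a1 [a2 ->]]]; rewrite phiE.
  have [le|lt] := leqP (d + 1 - e) n.
    rewrite (is_formE (n := n + e - d)); last by lia.
    apply: rpredB.
      case: leqP => [le'|_]; last by rewrite mul0r; apply: dhomog0.
      have -> : (n + e - d = n - (d + 2 - e) + 2)%N by lia.
      by apply: dhomogM => //; apply: pihomogP.
    have -> : (n + e - d = n - (d + 1 - e) + 1)%N by lia.
    by apply: dhomogM => //; apply: pihomogP.
  (* Below degree d + 1 - e neither [s 0] nor [s 1] occurs, so the image is 0, a form of every
     degree, negative ones included. *)
  rewrite ifF; last by apply/negbTE; rewrite -ltnNge; lia.
  rewrite !mul0r subrr; case: (_ + _) => z /=; last by [].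
  exact: dhomog0.
- move=> v; split=> [|[a ->]].
    have [a0 [a1 [a2 ->]]] := s_gen v; rewrite phiE => /eqP; rewrite subr_eq0 => /eqP e01.
    have : divides l (q * a0) by exists a1; rewrite mulrC e01 mulrC.
    case/(linear_form_prime l_homog nl) => // -[t e0].
    have e1 : a1 = q * t by apply: (mulfI nl); rewrite mulrC -e01 e0; ring.
    exists (a2 - t * c); rewrite scalerBl -(scalerA t) e0 e1.
    have -> : c *: s 2%:R = - (l *: s 0 + q *: s 1).
      by apply/eqP; rewrite -addr_eq0 addrC relation.
    by rewrite scalerN opprK scalerDr !scalerA addrC (mulrC t) (mulrC t q).
  have -> : a *: s 2%:R = 0 *: s 0 + 0 *: s 1 + a *: s 2%:R by rewrite !scale0r !add0r.
  by rewrite phiE !mul0r subrr.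
- move=> p; split=> [[a [b ->]]|[v <-]].
    by exists (b *: s 0 + (- a) *: s 1 + 0 *: s 2%:R); rewrite phiE; ring.
  have [a0 [a1 [a2 ->]]] := s_gen v; rewrite phiE.
  by exists (- a1), a0; ring.
Qed.

Lemma presentation_bourbaki_degree : bourbaki_degree f d 2.
Proof.
right; split; first exact: syz_not_free.
exists e, (s 2%:R), (ideal2 l q); split=> //.
- exists 3%N, s, 2%:R; split=> //.
    elim/ord3_ind; [by exists (d + 2 - e)%N | by exists (d + 1 - e)%N | by exists e].
  split=> [v|i gen].
    have [a0 [a1 [a2 ->]]] := s_gen v; exists (fun b => nth 0 [:: a0; a1; a2] b).
    rewrite -(syz_sum3 (fun b => nth 0 [:: a0; a1; a2] b)).
    by apply: eq_bigl => j; rewrite in_set0.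
  have [a ea] := gen (s i).
  (* Expressing [s i] through the others would give a relation with coefficient -1, whereas all
     coefficients of relations have zero constant term. *)
  pose b j : R := (if j == i then -1 else a j).
  have : \sum_j b j *: s j = 0.
    rewrite (bigD1 i) //= {1}/b eqxx scaleN1r {1}ea addrC; apply/eqP; rewrite subr_eq0.
    apply/eqP; apply: eq_big => j; first by rewrite in_set1.
    by rewrite /b => /negbTE ->.
  move=> /relation_coef0_ord /(_ i); rewrite /b eqxx mcoeffN mcoeff1 eqxx => /eqP.
  by rewrite oppr_eq0 oner_eq0.
- exact: presentation_bourbaki.
- by apply: ideal2_multiplicity => //; [exact: l_neq0 | exact: l_ndivides_q].
Qed.

End Presentation.

(** * From a minimal resolution to such a presentation *)

Section Backward.
Variables (k : closedFieldType) (f : {mpoly k[3]}) (d e : nat).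
Local Notation R := {mpoly k[3]}.
Hypothesis f_homog : f \is d.+1.-homog.
Hypothesis e_indeg : indeg_syz f e.

Let F : 'M[R]_(3, 1) := \matrix_(i, j) f^`M(i).

(* The three generators of J_f given by the resolution and the partial
   derivatives span the same space of forms of degree d. *)
Lemma change_of_generators m (B2 : 'M[R]_(m, 3)) (B1 : 'M[R]_(3, 1)) :
  (forall j, B1 j 0 \is d.-homog) -> minimal_mx B2 -> exact_at B2 B1 ->
  (forall p, gradient_ideal f p <-> exists v : 'rV_3, p = (v *m B1) 0 0) ->
  exists C D : 'M[k]_3, [/\ C *m D = 1%:M, D *m C = 1%:M,
    F = map_mx (@mpolyC 3 k) C *m B1 & B1 = map_mx (@mpolyC 3 k) D *m F].
Proof.
move=> hB1 minB2 ex gen.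
have hF i : f^`M(i) \is d.-homog by exact: mderiv_homog.
have /all_sig [C hC] : forall i, {c : 'I_3 -> k | f^`M(i) = \sum_j (c j)%:MP * B1 j 0}.
  move=> i; apply: constructive_indefinite_description.
  have /gen [v ev] : gradient_ideal f f^`M(i).
    exists (fun j => (j == i)%:R); rewrite (bigD1 i) //= eqxx mul1r big1 ?addr0 //.
    by move=> j /negbTE ->; rewrite mul0r.
  exists (fun j => (v 0 j)@_0%MM); rewrite mxE in ev.
  exact: constant_coefficients ev.
have /all_sig [D hD] : forall j, {c : 'I_3 -> k | B1 j 0 = \sum_i (c i)%:MP * f^`M(i)}.
  move=> j; apply: constructive_indefinite_description.
  have [a ea] : gradient_ideal f (B1 j 0).
    apply/gen; exists (delta_mx 0 j); rewrite mxE (bigD1 j) //= mxE !eqxx mul1r big1 ?addr0 //.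
    by move=> i /negbTE ni; rewrite mxE ni andbF mul0r.
  exists (fun j => (a j)@_0%MM).
  exact: constant_coefficients ea.
pose Cm : 'M[k]_3 := \matrix_(i, j) C i j; pose Dm : 'M[k]_3 := \matrix_(i, j) D i j.
have eF : F = map_mx (@mpolyC 3 k) Cm *m B1.
  apply/matrixP => i j; rewrite ord1 !mxE hC; apply: eq_bigr => a _.
  by rewrite !mxE.
have eB1 : B1 = map_mx (@mpolyC 3 k) Dm *m F.
  apply/matrixP => i j; rewrite ord1 [LHS]hD mxE; apply: eq_bigr => a _.
  by rewrite !mxE.
(* The rows of DC - 1 are constant relations on the entries of [B1]. By exactness they are
   combinations of the rows of [B2], which have zero constant terms by minimality, so they
   vanish. *)
have DC : Dm *m Cm = 1%:M.
  apply/row_matrixP => i; apply/eqP; rewrite -subr_eq0; apply/eqP.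
  pose r : 'rV[k]_3 := row i (Dm *m Cm - 1%:M).
  rewrite (_ : row i _ - row i _ = r); last by rewrite /r linearB.
  have /ex [v ev] : map_mx (@mpolyC 3 k) r *m B1 = 0.
    rewrite /r map_row map_mxB map_mxM map_mx1 -row_mul mulmxBl -mulmxA -eF -eB1.
    by rewrite mul1mx subrr linear0.
  apply/rowP => j; rewrite [RHS]mxE.
  have := congr1 (fun w : 'rV[R]_3 => (w 0 j)@_0%MM) ev.
  rewrite mxE mcoeffC eqxx mulr1 => ->.
  rewrite mxE raddf_sum big1 // => a _.
  by have := mcoeff0M (v 0 a) (B2 a j); rewrite minB2 mulr0.
exists Cm, Dm; split=> //; exact: mulmx1C.
Qed.

Lemma resolution_deg2 : (2 * e <= d + 1)%N ->
   graded_min_free_res (gradient_ideal f)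
     [tuple d%:Z + (d%:Z - e%:Z + 3)]
     [tuple d%:Z + (d%:Z - e%:Z + 2); d%:Z + (d%:Z - e%:Z + 1); d%:Z + e%:Z]
     [tuple d%:Z; d%:Z; d%:Z] ->
  bourbaki_degree f d 2.
Proof.
move=> e_le [B3 [B2 [B1 [[g3 g2 g1] [m3 m2 m1] [inj ex3 ex2 gen]]]]].
have hB1 j : B1 j 0 \is d.-homog.
  have := g1 j 0; rewrite (is_formE (n := d)) //.
  by elim/ord3_ind: j; rewrite !(tnth_nth 0) /=; lia.
have [C [D [CD DC eF eB1]]] := change_of_generators hB1 m2 ex2 gen.
pose C' := map_mx (@mpolyC 3 k) C; pose D' := map_mx (@mpolyC 3 k) D.
have CD' : C' *m D' = 1%:M by rewrite -map_mxM CD map_mx1.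
have DC' : D' *m C' = 1%:M by rewrite -map_mxM DC map_mx1.
(* Since F = C' B1, a row u is a syzygy of F exactly when u C' is one of [B1]; multiplying the rows
   of [B2] by the inverse of C' therefore gives generators of Syz. *)
pose S := B2 *m D'.
have genS (u : 'rV[R]_3) : u *m F = 0 <-> exists v : 'rV_3, u = v *m S.
  rewrite eF mulmxA ex2; split=> [[v ev]|[v ->]]; exists v.
    by rewrite /S mulmxA -ev -mulmxA CD' mulmx1.
  by rewrite /S -!mulmxA DC' mulmx1.
have relS (v : 'rV[R]_3) : v *m S = 0 <-> exists w : 'rV_1, v = w *m B3.
  rewrite -ex3 /S; split=> h; last by rewrite mulmxA h mul0mx.
  by rewrite -[v *m B2]mulmx1 -DC' !mulmxA -(mulmxA v) h mul0mx.
have homS n i : (forall j, B2 i j \is n.-homog) -> forall j, S i j \is n.-homog.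
  move=> h j; rewrite mxE; apply: rpred_sum => a _; rewrite mxE mulrC mul_mpolyC.
  exact: rpredZ.
have S_syz i : row i S \in syz_pred f.
  have h : row i S *m F = 0 by apply/genS; exists (delta_mx 0 i); rewrite rowE.
  apply/eqP; have /matrixP /(_ 0 0) := h; rewrite [LHS]mxE [RHS]mxE => e0.
  by rewrite -[RHS]e0; apply: eq_bigr => a _; rewrite [F a 0]mxE.
pose s i : Syz f := MkSyz (S_syz i).
have sE i j : syz_val (s i) 0 j = S i j by rewrite /= mxE.
have hs (z : int) n i : (forall j, tnth [tuple d%:Z + (d%:Z - e%:Z + 2);
     d%:Z + (d%:Z - e%:Z + 1); d%:Z + e%:Z] i - tnth [tuple d%:Z; d%:Z; d%:Z] j = n%:Z) ->
    syz_homog n (s i).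
  by move=> h j; rewrite sE; apply: homS => {}j; rewrite -(is_formE _ (h j)); apply: g2.
have hs0 : syz_homog (d + 2 - e) (s 0).
  by apply: (hs 0) => j; elim/ord3_ind: j; rewrite !(tnth_nth 0) /=; lia.
have hs1 : syz_homog (d + 1 - e) (s 1).
  by apply: (hs 0) => j; elim/ord3_ind: j; rewrite !(tnth_nth 0) /=; lia.
have hs2 : syz_homog e (s 2%:R).
  by apply: (hs 0) => j; elim/ord3_ind: j; rewrite !(tnth_nth 0) /=; lia.
have hl : B3 0 0 \is 1.-homog.
  by have := g3 0 0; rewrite (is_formE (n := 1)) // !(tnth_nth 0) /=; lia.
have hq : B3 0 1 \is 2.-homog.
  by have := g3 0 1; rewrite (is_formE (n := 2)) // !(tnth_nth 0) /=; lia.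
have comb_val (v : 'rV[R]_3) j : syz_val (\sum_i v 0 i *: s i) 0 j = (v *m S) 0 j.
  by rewrite sum_ord3 syz_val_comb3 !sE [RHS]mxE sum_ord3.
have combE (v : 'rV[R]_3) : \sum_i v 0 i *: s i = 0 <-> v *m S = 0.
  split=> h; first by apply/rowP => j; rewrite -comb_val h [LHS]syz_val0 mxE.
  by apply: syz_eqP => j; rewrite comb_val h !mxE.
apply: (@presentation_bourbaki_degree k f d e s (B3 0 0) (B3 0 1) (B3 0 2%:R)) => //.
- move=> v.
  have /genS [u eu] : syz_val v *m F = 0.
    apply/matrixP => i j; rewrite !ord1 !mxE; apply: etrans (syz_rel v).
    by apply: eq_bigr => a _; rewrite mxE.
  exists (u 0 0), (u 0 1), (u 0 2%:R); apply: syz_eqP => j.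
  by rewrite syz_val_comb3 !sE eu [LHS]mxE sum_ord3.
- move=> a0 a1 a2; pose v : 'rV[R]_3 := \row_b nth 0 [:: a0; a1; a2] b.
  have ev : \sum_i v 0 i *: s i = a0 *: s 0 + a1 *: s 1 + a2 *: s 2%:R.
    by rewrite sum_ord3 !mxE.
  rewrite -ev combE relS; split=> [[w ew]|[t [e0 e1 e2]]].
    have wE j : v 0 j = w 0 0 * B3 0 j by rewrite ew mxE big_ord1.
    by exists (w 0 0); split; rewrite -wE mxE.
  exists t%:M; apply/rowP => j; rewrite mul_scalar_mx [RHS]mxE.
  by elim/ord3_ind: j; rewrite mxE.
- move=> t h0 h1 h2.
  have : (t%:M : 'rV[R]_1) = 0.
    apply: inj; apply/rowP => j; rewrite mul_scalar_mx [LHS]mxE [RHS]mxE.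
    by elim/ord3_ind: j.
  by move/(congr1 (fun w : 'rV_1 => w 0 0)); rewrite !mxE.
Qed.
End Backward.

Theorem proposition2p19 (k : closedFieldType) (f : {mpoly k[3]}) (d e : nat)
  (d_ge1 : (1 <= d)%N)
  (char_d : forall p, p \in [pchar k] -> ~~ (p %| d.+1)%N)
  (f_neq0 : f != 0)
  (f_homog : f \is d.+1.-homog)
  (f_reduced : reduced_quotient f)
  (f_singular : singular_curve f)
  (e_indeg : indeg_syz f e) :
  bourbaki_degree f d 2 <->
  ((2 * e <= d + 1)%N /\
   graded_min_free_res (gradient_ideal f)
     [tuple d%:Z + (d%:Z - e%:Z + 3)]
     [tuple d%:Z + (d%:Z - e%:Z + 2); d%:Z + (d%:Z - e%:Z + 1); d%:Z + e%:Z]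
     [tuple d%:Z; d%:Z; d%:Z]).
Proof.
split=> [[[_ //]|[_ [e' [eps [I [e'_indeg eps_homog [n [g [i [_ [gen min] eg]]]] bI mult]]]]]]|].
  have ee : e' = e.
    have [[v hv nv] mv] := e_indeg; have [[w hw nw] mw] := e'_indeg.
    by apply/eqP; rewrite eqn_leq (mw e v) ?(mv e' w).
  subst e'; apply: (deg2_resolution f_homog e_indeg eps_homog _ bI mult d_ge1).
  (* A zero member of a minimal system of generators could be dropped. *)
  apply/eqP => eps0; apply: (min i) => v; have [a ->] := gen v; exists a.
  rewrite (bigD1 i) ?in_set0 //= -eg eps0 scaler0 add0r.
  by apply: eq_bigl => j; rewrite in_set0 in_set1.
by case=> e_le res; exact: (resolution_deg2 f_homog e_indeg e_le res).
Qed.
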